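(* Let $M$ be a connected smooth manifold, $\alpha$ a Riemannian metric on $M$ and $\beta$ a differential 1-form on $M$, and let $(M,F)$ be a Finsler space with $F=\sqrt[4]{\alpha^4+\beta^4}+\beta$, i.e. $F=\tilde F+\beta$ where $\tilde F=\sqrt[4]{\alpha^4+\beta^4}$. Then $(M,F)$ is with reversible geodesics if and only if the differential 1-form $\beta$ is closed on $M$.
   Context: Here $\alpha=\alpha(x,y)=\sqrt{a_{ij}(x)y^iy^j}$ is the norm on $TM$ of a Riemannian metric and $\beta=\beta(x,y)=b_i(x)y^i$ is a smooth 1-form regarded as a function on $TM$; $F=\sqrt[4]{\alpha^4+\beta^4}+\beta$ is a function on $TM$ assumed to be a Finsler metric (positive, positively 1-homogeneous in $y$, smooth off the zero section, strongly convex; not necessarily symmetric under $y\mapsto -y$). It is called the Randers change of the Quartic metric $\tilde F=\sqrt[4]{\alpha^4+\beta^4}$. Geodesics are those of the Finsler metric in the usual sense, considered as oriented paths (up to orientation-preserving reparametrization). A Finsler space $(M,F)$ is said to be with reversible geodesics if for every one of its oriented geodesic paths, the same path traversed in the opposite sense is also a geodesic of $F$; that is, for any geodesic $\gamma:[0,1]\to M$ of $F$, the reverse curve $\tilde\gamma(t)=\gamma(1-t)$ is also a geodesic of $F$ (up to orientation-preserving reparametrization). Equivalently, $F$ and its reverse metric $(x,y)\mapsto F(x,-y)$ are projectively equivalent, i.e. their geodesics coincide as sets of points. *)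

(* Defs.v *)
From HB Require Import structures.
From mathcomp Require Import all_boot all_order all_algebra.
From mathcomp Require Import all_classical all_reals all_analysis.

Set Implicit Arguments.
Unset Strict Implicit.
Unset Printing Implicit Defensive.

Import Order.TTheory GRing.Theory Num.Theory.
Import numFieldNormedType.Exports.

Local Open Scope classical_set_scope.
Local Open Scope ring_scope.

Fixpoint iter_derive (R : realType) (V W : normedModType R)
    (vs : seq V) (f : V -> W) : V -> W :=
  if vs is v :: vs' then (fun x => 'D_v (iter_derive vs' f) x) else f.

(* C^oo on U, to be used with U open: every iterated directional derivative
   exists and is continuous at each point of U. *)
Definition smooth_on (R : realType) (V W : normedModType R)
    (U : set V) (f : V -> W) : Prop :=
  forall (vs : seq V) (x : V), U x ->
    {for x, continuous (iter_derive vs f)} /\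
    forall v : V, derivable (iter_derive vs f) x v.

(* A smooth atlas of dimension n, not necessarily maximal.  chart_inv i is a
   total function, relevant only on the image of the i-th chart. *)
Record smooth_atlas (R : realType) (n : nat) (M : topologicalType) := SmoothAtlas {
  chart : Type ;
  chart_dom : chart -> set M ;
  chart_map : chart -> M -> 'rV[R]_n ;
  chart_inv : chart -> 'rV[R]_n -> M ;
  chart_cover : forall p, exists i, chart_dom i p ;
  chart_dom_open : forall i, open (chart_dom i) ;
  chart_img_open : forall i, open (chart_map i @` chart_dom i) ;
  chart_mapK : forall i p, chart_dom i p -> chart_inv i (chart_map i p) = p ;
  chart_map_continuous : forall i p, chart_dom i p ->
    {for p, continuous (chart_map i)} ;
  chart_inv_continuous : forall i x, (chart_map i @` chart_dom i) x ->
    {for x, continuous (chart_inv i)} ;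
  chart_transition_smooth : forall i j,
    smooth_on (chart_map i @` (chart_dom i `&` chart_dom j))
      (chart_map j \o chart_inv i) }.

Arguments chart {R n M} _.
Arguments chart_dom {R n M} _ _.
Arguments chart_map {R n M} _ _ _.
Arguments chart_inv {R n M} _ _ _.

Record smooth_manifold (R : realType) (n : nat) (M : topologicalType) := SmoothManifold {
  atlas :> smooth_atlas R n M ;
  manifold_hausdorff : hausdorff_space M ;
  manifold_second_countable : @second_countable M }.

Section geometry.
Variables (R : realType) (n : nat) (M : topologicalType).
Variable A : smooth_atlas R n M.

Definition chart_img (i : chart A) : set 'rV[R]_n :=
  chart_map A i @` chart_dom A i.

Definition overlap (i j : chart A) : set 'rV[R]_n :=
  chart_map A i @` (chart_dom A i `&` chart_dom A j).

Definition transition (i j : chart A) : 'rV[R]_n -> 'rV[R]_n :=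
  chart_map A j \o chart_inv A i.

(* Local expressions L i x y of a function on TM: x is the point read in the
   chart i, and y the components of the tangent vector in that chart. *)
Definition local_expr : Type := chart A -> 'rV[R]_n -> 'rV[R]_n -> R.

(* Changing from chart i to chart j sends the vector (x, y) to
   (tau x, dtau_x y), where tau is the transition map. *)
Definition tangent_function (L : local_expr) : Prop :=
  forall (i j : chart A) (x y : 'rV[R]_n), overlap i j x ->
    L i x y = L j (transition i j x) ('D_y (transition i j) x).

Definition quad_form (a : 'M[R]_n) (y : 'rV[R]_n) : R :=
  \sum_(k < n) \sum_(l < n) a k l * y 0 k * y 0 l.

Definition lin_form (b y : 'rV[R]_n) : R := \sum_(k < n) b 0 k * y 0 k.

(* Since the coefficient matrices are symmetric, compatibility of the quadratic
   forms is the transformation law of a symmetric (0,2)-tensor. *)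
Record riemannian_metric := RiemannianMetric {
  metric_coef : chart A -> 'rV[R]_n -> 'M[R]_n ;
  metric_smooth : forall i, smooth_on (chart_img i) (metric_coef i) ;
  metric_sym : forall i x, chart_img i x ->
    (metric_coef i x)^T = metric_coef i x ;
  metric_posdef : forall i x y, chart_img i x -> y != 0 ->
    0 < quad_form (metric_coef i x) y ;
  metric_compat : tangent_function (fun i x y => quad_form (metric_coef i x) y) }.

Record one_form := OneForm {
  form_coef : chart A -> 'rV[R]_n -> 'rV[R]_n ;
  form_smooth : forall i, smooth_on (chart_img i) (form_coef i) ;
  form_compat : tangent_function (fun i x y => lin_form (form_coef i x) y) }.

Definition metric_norm (g : riemannian_metric) : local_expr :=
  fun i x y => Num.sqrt (quad_form (metric_coef g i x) y).

Definition form_fun (b : one_form) : local_expr :=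
  fun i x y => lin_form (form_coef b i x) y.

(* db(u, v) for vectors u, v with constant components in the chart i *)
Definition ext_derivative (b : one_form) (i : chart A) (x u v : 'rV[R]_n) : R :=
  'D_u (fun z => form_fun b i z v) x - 'D_v (fun z => form_fun b i z u) x.

Definition closed_form (b : one_form) : Prop :=
  forall (i : chart A) (x u v : 'rV[R]_n), chart_img i x ->
    ext_derivative b i x u v = 0.

Definition quartic_metric (g : riemannian_metric) (b : one_form) : local_expr :=
  fun i x y => (metric_norm g i x y ^+ 4 + form_fun b i x y ^+ 4) `^ (4%:R^-1).

Definition randers_change (L : local_expr) (b : one_form) : local_expr :=
  fun i x y => L i x y + form_fun b i x y.

(* g_(x,y)(u, v) = 1/2 d^2 F^2(x, y + s u + t v) / ds dt at s = t = 0 *)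
Definition fundamental_tensor (F : local_expr) (i : chart A)
    (x y u v : 'rV[R]_n) : R :=
  2%:R^-1 * 'D_u (fun z => 'D_v (fun w => F i x w ^+ 2) z) y.

Record finsler_metric (F : local_expr) : Prop := FinslerMetric {
  finsler_compat : tangent_function F ;
  finsler_smooth : forall i : chart A,
    smooth_on [set p : 'rV[R]_n * 'rV[R]_n | chart_img i p.1 /\ p.2 != 0]
      (fun p => F i p.1 p.2) ;
  finsler_pos : forall i x y, chart_img i x -> y != 0 -> 0 < F i x y ;
  finsler_homogeneous : forall i x y (l : R), chart_img i x -> 0 < l ->
    F i x (l *: y) = l * F i x y ;
  finsler_convex : forall i x y v, chart_img i x -> y != 0 -> v != 0 ->
    0 < fundamental_tensor F i x y v v }.

Definition smooth_curve (O : set R) (c : R -> M) : Prop :=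
  (forall t, O t -> {for t, continuous c}) /\
  forall i : chart A,
    smooth_on (O `&` (c @^-1` chart_dom A i)) (chart_map A i \o c).

Definition energy (F : local_expr) : local_expr :=
  fun i x y => 2%:R^-1 * F i x y ^+ 2.

(* A curve on [0, 1] is smooth when it is so on a neighbourhood of [0, 1]; its
   values far from [0, 1] are irrelevant.  A geodesic is a regular smooth curve
   solving the Euler-Lagrange equations of F^2/2,
     d/dt (dE/dy^k (c, c')) = dE/dx^k (c, c'),
   in every chart it meets; in particular it has constant F-speed. *)
Definition geodesic (F : local_expr) (gam : R -> M) : Prop :=
  (exists2 e : R, 0 < e & smooth_curve `]- e, 1 + e[ gam) /\
  forall (t : R) (i : chart A), 0 <= t <= 1 -> chart_dom A i (gam t) ->
    let c := chart_map A i \o gam in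
    derive1 c t != 0 /\
    forall k : 'I_n,
      is_derive t 1
        (fun s => 'D_(delta_mx 0 k) (fun y => energy F i (c s) y) (derive1 c s))
        ('D_(delta_mx 0 k) (fun x => energy F i x (derive1 c t)) (c t)).

Definition reparametrization (phi : R -> R) : Prop :=
  [/\ exists2 e : R, 0 < e & smooth_on `]- e, 1 + e[ phi,
      phi 0 = 0, phi 1 = 1 & forall t, 0 <= t <= 1 -> 0 < derive1 phi t].

Definition geodesic_path (F : local_expr) (gam : R -> M) : Prop :=
  exists2 phi, reparametrization phi & geodesic F (gam \o phi).

Definition reversible_geodesics (F : local_expr) : Prop :=
  forall gam : R -> M,
    geodesic_path F gam -> geodesic_path F (fun t => gam (1 - t)).

End geometry.

(* Main.v *)
(* Write F(x, y) = G(x, y) + beta(y) with G(x, -y) = G(x, y), so that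
   F(x, -y) = F(x, y) - 2 beta(y).  By homogeneity, the Euler-Lagrange
   equations of F^2 / 2 along a regular curve say that F is constant along
   the curve and that the equations of F itself hold, and the latter do not
   depend on the parametrization.  If a curve c solves them, then traversing
   c backwards changes them by a multiple of d beta(c', .) only.  Hence when
   beta is closed the reversed geodesic, parametrized by constant speed, is a
   geodesic.  Conversely, through each point there is a geodesic in each
   direction u, and if its reverse is a geodesic path then d beta(u, .) = 0
   there.

   Geodesics come from Picard iteration for the spray, whose existence rests
   on the invertibility of the fundamental tensor.  Being a geodesic has to
   be checked in every chart, which uses the symmetry of second derivatives
   of the transition maps. *)
Require Import Defs.
From HB Require Import structures.
From mathcomp Require Import all_boot all_order all_algebra.
From mathcomp Require Import ring lra.
From mathcomp Require Import all_classical all_reals all_analysis.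

Set Implicit Arguments.
Unset Strict Implicit.
Unset Printing Implicit Defensive.

Import Order.TTheory GRing.Theory Num.Theory.
Import numFieldNormedType.Exports.

Local Open Scope classical_set_scope.
Local Open Scope ring_scope.

(** * Calculus in finite dimension *)

(** [geodesic] forces constant F-speed, while F(c, -c') is in general not constant along a geodesic
    c, since F is not symmetric. Hence t -> c(1 - t) has to be reparametrized: the parameter theta
    solves theta' = -K / h(theta), where h = F(c, -c'), and this gives the reversed curve F-speed K.
    Geodesics are defined over all of [0, 1], whereas the spray only has short solutions. A solution
    z is therefore rescaled to z(a t), and the geodesic obtained has velocity a u for some a > 0;
    this suffices because d beta(a u, .) = a d beta(u, .). [smooth_on] speaks of directional
    derivatives only. Frechet differentiability, on which the chain rule and linearity in the
    direction rest, is recovered from the continuity of these derivatives; smoothness of composites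
    and of solutions of differential equations is obtained by exhibiting a class of functions stable
    under derivation. *)

Section directional.
Variables (R : realType).

Lemma open_near (T : topologicalType) (U : set T) x :
  open U -> U x -> \forall y \near x, U y.
Proof. by move=> oU Ux; apply: open_nbhs_nbhs. Qed.

Lemma is_derive_line (V W : normedModType R) (f : V -> W) (z v : V) (s : R) :
  derivable f (z + s *: v) v ->
  is_derive s 1 (fun t => f (z + t *: v)) ('D_v f (z + s *: v)).
Proof.
have E : (fun h => h^-1 *: (((fun t => f (z + t *: v)) \o shift s) (h *: (1:R)) - f
  (z + s *: v)))
  = (fun h => h^-1 *: ((f \o shift (z + s *: v)) (h *: v) - f (z + s *: v))).
  apply/funext => h /=; congr (_ *: (f _ - _)).
  by rewrite [h *: 1]mulr1 scalerDl addrCA.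
by move=> df; split; rewrite /derivable /derive E.
Qed.

(** Derivability along [v] alone does not give a linear differential at [x]. On the line through [x]
    in direction [v], however, derivable and differentiable coincide, and the chain rule with
    multiplication by [a] produces the factor, for [a = 0] too. *)
Lemma is_derive_scale (V W : normedModType R) (f : V -> W) (x v : V) (a : R) :
  derivable f x v -> is_derive x (a *: v) f (a *: 'D_v f x).
Proof.
move=> df.
have d0 : is_derive (0:R) 1 (fun t => f (x + t *: v)) ('D_v f x).
  have := @is_derive_line V W f x v 0.
  by rewrite scale0r addr0; apply.
have dc : differentiable (fun t : R => f (x + t *: v)) 0.
  exact/derivable1_diffP.
have da : differentiable (fun t : R => a * t) 0 by [].
have E : (fun h => h^-1 *: ((f \o shift x) (h *: (a *: v)) - f x))
  = (fun h =>
    h^-1 *: ((((fun t : R => f (x + t *: v)) \o (fun t : R => a * t)) \o shift 0)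
      (h *: (1:R))
      - ((fun t : R => f (x + t *: v)) \o (fun t : R => a * t)) 0)).
  apply/funext => h /=; rewrite mulr0 scale0r addr0 addr0 [h *: 1]mulr1.
  by rewrite scalerA [h * a]mulrC [x + _]addrC.
have dd : differentiable ((fun t : R => f (x + t *: v)) \o (fun t : R => a * t)) 0.
  by apply: differentiable_comp => //; rewrite mulr0.
split.
  rewrite /derivable E.
  exact: diff_derivable.
have -> : 'D_(a *: v) f x
  = 'D_1 ((fun t : R => f (x + t *: v)) \o (fun t : R => a * t)) 0.
  by rewrite /derive E.
rewrite deriveE// diff_comp//; last by rewrite mulr0.
rewrite /= mulr0 -(@derive_val _ _ _ _ _ _ _ d0) deriveE//.
rewrite -linearZ/=; congr ('d _ _ _).
by rewrite -deriveE// (_ : (fun t => _) = a \*: id)// deriveZ// derive_id.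
Qed.

Lemma mvt_line (V : normedModType R) (f : V -> R) (z v : V) :
  (forall s : R, 0 <= s <= 1 -> derivable f (z + s *: v) v) ->
  exists2 s : R, 0 < s < 1 & f (z + v) - f z = 'D_v f (z + s *: v).
Proof.
move=> df.
have dl (s : R) : 0 <= s <= 1 ->
    is_derive s 1 (fun t => f (z + t *: v)) ('D_v f (z + s *: v)).
  by move=> /df; exact: is_derive_line.
have [||s] := @MVT R (fun t => f (z + t *: v)) (fun s => 'D_v f (z + s *: v)) 0 1 ltr01.
- move=> s; rewrite in_itv/= => /andP[s0 s1]; apply: dl; rewrite (ltW s0) ltW//.
- apply: derivable_within_continuous => s; rewrite in_itv/= => /dl ds.
  exact: (@ex_derive _ _ _ _ _ _ _ ds).
rewrite in_itv/= => s01; rewrite scale1r scale0r addr0 subr0 mulr1 => E.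
by exists s.
Qed.

End directional.

(* A basis whose coordinate functions are bounded by the norm; it allows one
   treatment of R, of 'rV_n and of the phase space 'rV_n * 'rV_n. *)
Class finite_dim (R : realType) (V : normedModType R) := FiniteDim {
  fdim : nat ;
  fvec : 'I_fdim -> V ;
  fcoord : 'I_fdim -> V -> R ;
  fcoord_lin : forall i a u v,
    fcoord i (a *: u + v) = a * fcoord i u + fcoord i v ;
  fcoord_le : forall i v, `|fcoord i v| <= `|v| ;
  fcoord_vec : forall i j, fcoord i (fvec j) = (i == j)%:R ;
  fcoordE : forall v, v = \sum_i fcoord i v *: fvec i }.

Arguments fdim {R} V {_}.

Section finite_dim_theory.
Context {R : realType} {V : normedModType R} {fV : finite_dim V}.

Lemma fcoord0 i : fcoord i (0 : V) = 0.
Proof.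
have := fcoord_lin i (-1) (0 : V) 0.
by rewrite scaler0 addr0 mulN1r addNr.
Qed.

Lemma fcoordD i (u v : V) : fcoord i (u + v) = fcoord i u + fcoord i v.
Proof. by rewrite -[u]scale1r fcoord_lin mul1r scale1r. Qed.

Lemma fcoordZ i a (u : V) : fcoord i (a *: u) = a * fcoord i u.
Proof. by rewrite -[a *: u]addr0 fcoord_lin fcoord0 addr0. Qed.

Lemma fcoordN i (u : V) : fcoord i (- u) = - fcoord i u.
Proof. by rewrite -scaleN1r fcoordZ mulN1r. Qed.

Lemma fcoordB i (u v : V) : fcoord i (u - v) = fcoord i u - fcoord i v.
Proof. by rewrite fcoordD fcoordN. Qed.

Lemma fcoord_sum i (I : Type) (r : seq I) (P : pred I) (F : I -> V) :
  fcoord i (\sum_(j <- r | P j) F j) = \sum_(j <- r | P j) fcoord i (F j).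
Proof. by elim/big_rec2: _ => [|j a b _ <-]; rewrite ?fcoord0 ?fcoordD. Qed.

Lemma fcoord_vec_sum (c : 'I_(fdim V) -> R) i : fcoord i (\sum_j c j *: fvec j) = c i.
Proof.
rewrite fcoord_sum (bigD1 i)//= fcoordZ fcoord_vec eqxx mulr1 big1 ?addr0//.
by move=> j ji; rewrite fcoordZ fcoord_vec eq_sym (negPf ji) mulr0.
Qed.

Lemma fcoord_continuous i : continuous (fcoord i : V -> R).
Proof.
move=> x; apply/cvgrPdist_lt => e e0; near=> y.
rewrite -fcoordB; apply: le_lt_trans (fcoord_le _ _) _.
by near: y; apply: cvgr_dist_lt.
Unshelve. all: by end_near. Qed.

Lemma cvg_bigsum (W : normedModType R) (T I : Type) (F : set_system T)
    (FF : Filter F) (r : seq I) (f : I -> T -> W) (l : I -> W) :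
  (forall i, f i x @[x --> F] --> l i) ->
  \sum_(i <- r) f i x @[x --> F] --> \sum_(i <- r) l i.
Proof.
move=> fl; elim: r => [|i r IH].
  by rewrite big_nil; under eq_fun do rewrite big_nil; exact: cvg_cst.
by rewrite big_cons; under eq_fun do rewrite big_cons; exact: cvgD.
Qed.

Lemma cvg_fcoord (T : Type) (F : set_system T) (FF : Filter F) (f : T -> V) (l : V) :
  (forall i, fcoord i (f x) @[x --> F] --> fcoord i l) -> f @ F --> l.
Proof.
move=> fl; rewrite (fcoordE l).
rewrite (_ : f = fun x => \sum_i fcoord i (f x) *: fvec i); last first.
  by apply/funext => x; rewrite -fcoordE.
apply: cvg_bigsum => i; apply: cvgZr_tmp; exact: fl.
Qed.

Lemma continuous_fcoord (T : topologicalType) (f : T -> V) (x : T) :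
  (forall i, {for x, continuous (fun y => fcoord i (f y))}) -> {for x, continuous f}.
Proof. by move=> fl; apply: cvg_fcoord. Qed.

Lemma is_derive_fcoord (W : normedModType R) (f : W -> V) (x v : W) (l : V) :
  (forall i, is_derive x v (fun y => fcoord i (f y)) (fcoord i l)) <->
  is_derive x v f l.
Proof.
have E i h : h^-1 *: (((fun y => fcoord i (f y)) \o shift x) (h *: v) - fcoord i (f x))
  = fcoord i (h^-1 *: ((f \o shift x) (h *: v) - f x)).
  by rewrite fcoordZ fcoordB.
split.
  move=> fi.
  have H : (fun h => h^-1 *: ((f \o shift x) (h *: v) - f x)) @ 0^' --> l.
    apply: cvg_fcoord => i.
    under eq_fun do rewrite -E.
    have := fi i; case => + <-; apply.
  by split; [apply/cvg_ex; exists l | apply/cvg_lim].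
move=> [fd fl] i.
have H : (fun h => h^-1 *: (((fun y => fcoord i (f y)) \o shift x) (h *: v)
     - fcoord i (f x))) @ 0^' --> fcoord i l.
  under eq_fun do rewrite E.
  apply: (@cvg_comp _ _ _ _ (fcoord i) _ (nbhs l)); last exact: fcoord_continuous.
  by rewrite -fl; exact: fd.
by split; [apply/cvg_ex; eexists; exact: H | apply/cvg_lim].
Qed.

Lemma derivable_fcoord (W : normedModType R) (f : W -> V) (x v : W) :
  derivable f x v <-> forall i, derivable (fun y => fcoord i (f y)) x v.
Proof.
split.
  move=> /derivableP/is_derive_fcoord fd i.
  exact: (@ex_derive _ _ _ _ _ _ _ (fd i)).
move=> fi; pose l : V := \sum_i 'D_v (fun y => fcoord i (f y)) x *: @fvec R V fV i.
suff /is_derive_fcoord[//] : forall i : 'I_(@fdim R V fV),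
    is_derive x v (fun y => fcoord i (f y)) (fcoord i l).
by move=> i; split; [exact: fi | rewrite /l fcoord_vec_sum].
Qed.

Lemma derive_fcoord (W : normedModType R) (f : W -> V) (x v : W) i :
  derivable f x v -> 'D_v (fun y => fcoord i (f y)) x = fcoord i ('D_v f x).
Proof.
move=> /derivableP/is_derive_fcoord fd.
by have := fd i => /@derive_val.
Qed.

Lemma is_derive_coord i (x v : V) : is_derive x v (fcoord i : V -> R) (fcoord i v).
Proof. by move: i; apply/(is_derive_fcoord id); exact: is_derive_id. Qed.

End finite_dim_theory.

#[local] Obligation Tactic := idtac.

Section instances.
Variable R : realType.

Program Definition finite_dim_R : finite_dim R :=
  @FiniteDim R R 1 (fun=> 1) (fun=> id) _ _ _ _.
Next Obligation. by []. Qed.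
Next Obligation. by move=> i v /=. Qed.
Next Obligation. by move=> i j /=; rewrite (ord1 i) (ord1 j) eqxx. Qed.
Next Obligation. by move=> v; rewrite big_ord1 [_ *: _]mulr1. Qed.

Program Definition finite_dim_rV n : finite_dim 'rV[R]_n :=
  @FiniteDim R 'rV[R]_n n (fun i => delta_mx 0 i) (fun i v => v 0 i) _ _ _ _.
Next Obligation. by move=> n i a u v /=; rewrite !mxE. Qed.
Next Obligation.
move=> n i v /=; rewrite [leRHS]/Num.Def.normr/= mx_normrE.
by apply: le_trans; last exact: (le_bigmax _ _ (0, i)).
Qed.
Next Obligation. by move=> n i j /=; rewrite mxE eqxx eq_sym. Qed.
Next Obligation. by move=> n v; rewrite [LHS]row_sum_delta. Qed.

Program Definition finite_dim_prod (V W : normedModType R)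
    (fV : finite_dim V) (fW : finite_dim W) : finite_dim (V * W)%type :=
  @FiniteDim R (V * W)%type (fdim V + fdim W)
    (fun k => match fintype.split k with inl i => (fvec i, 0) | inr i => (0, fvec i) end)
    (fun k p => match fintype.split k with inl i => fcoord i p.1 | inr i =>
      fcoord i p.2 end)
    _ _ _ _.
Next Obligation.
by move=> V W fV fW k a u v /=; case: fintype.split => i; rewrite fcoord_lin.
Qed.
Next Obligation.
move=> V W fV fW k [u v] /=; rewrite prod_normE le_max.
by case: fintype.split => i; rewrite fcoord_le ?orbT.
Qed.
Next Obligation.
move=> V W fV fW j k /=; rewrite -(splitK j) -(splitK k) !unsplitK.
case: (fintype.split j) => i; case: (fintype.split k) => i' /=;
  rewrite ?fcoord_vec ?fcoord0.
- by rewrite eq_lshift.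
- by rewrite eq_lrshift.
- by rewrite eq_rlshift.
- by rewrite eq_rshift.
Qed.
Next Obligation.
move=> V W fV fW [u v]; rewrite big_split_ord/=.
under eq_bigr do rewrite (unsplitK (inl _)).
under [X in _ + X]eq_bigr do rewrite (unsplitK (inr _)).
have E1 n (c : 'I_n -> R) (e : 'I_n -> V) :
    \sum_(i < n) c i *: (e i, 0 : W) = (\sum_(i < n) c i *: e i, 0).
  elim/big_rec2: _ => // i x _ _ ->.
  by congr pair; rewrite /= scaler0 addr0.
have E2 n (c : 'I_n -> R) (e : 'I_n -> W) :
    \sum_(i < n) c i *: (0 : V, e i) = (0, \sum_(i < n) c i *: e i).
  elim/big_rec2: _ => // i x _ _ ->.
  by congr pair; rewrite /= scaler0 addr0.
rewrite E1 E2 -!fcoordE.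
by congr pair; rewrite /= ?addr0 ?add0r.
Qed.

Lemma fcoord_inl (V W : normedModType R) (fV : finite_dim V) (fW : finite_dim W)
    (i : 'I_(@fdim R V fV)) (p : V * W) :
  fcoord (finite_dim := finite_dim_prod fV fW) (unsplit (inl i)) p = fcoord i p.1.
Proof.
rewrite /fcoord /finite_dim_prod; cbn -[fintype.split unsplit]. by rewrite unsplitK.
Qed.

Lemma fcoord_inr (V W : normedModType R) (fV : finite_dim V) (fW : finite_dim W)
    (i : 'I_(@fdim R W fW)) (p : V * W) :
  fcoord (finite_dim := finite_dim_prod fV fW) (unsplit (inr i)) p = fcoord i p.2.
Proof.
rewrite /fcoord /finite_dim_prod; cbn -[fintype.split unsplit]; by rewrite unsplitK.
Qed.

End instances.

#[global] Existing Instance finite_dim_R.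
#[global] Existing Instance finite_dim_rV.
#[global] Existing Instance finite_dim_prod.

(** * Continuous directional derivatives give differentiability *)

Section C1.
Context {R : realType} {V : normedModType R} {fV : finite_dim V}.

(* Strict differentiability, by induction on the list [s] of directions in which
   the increment is taken. *)
Lemma C1_strictly_differentiable (f : V -> R) (x : V) (s : seq 'I_(fdim V)) :
  (\forall z \near x, forall v, derivable f z v) ->
  (forall v, {for x, continuous ('D_v f)}) ->
  forall e : R, 0 < e -> exists2 d : R, 0 < d &
  forall z h : V, `|z - x| < d -> `|h| < d ->
  `|f (z + \sum_(i <- s) fcoord i h *: fvec i) - f z -
    \sum_(i <- s) fcoord i h * 'D_(fvec i) f x| <= (size s)%:R * e * `|h|.
Proof.
move=> df cf e e0; elim: s => [|i s [d1 d10 IH]].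
  exists 1 => // z h _ _.
  by rewrite !big_nil addr0 subrr subr0 normr0 mul0r mul0r.
have /(@nbhs_ballP R V) [d2 /= d20 H2] : \forall z \near x, (forall v, derivable f z v) /\
    `|'D_(fvec i) f x - 'D_(fvec i) f z| < e.
  have /cvgrPdist_lt/(_ _ e0) := cf (fvec i).
  exact: filterS2 df.
(* Starting within d of [x] and adding a multiple of [fvec i] with coefficient at most d leads no
   further than d * C from [x]; with d * C = min d1 d2 the whole move stays in both
   neighbourhoods. *)
pose C := 1 + `|fvec i : V|.
have C1 : 1 <= C by rewrite lerDl.
have C0 : 0 < C by apply: lt_le_trans C1.
pose d := Num.min d1 d2 / C.
have dC : d * C = Num.min d1 d2 by rewrite /d divfK// gt_eqF.
have d0 : 0 < d by rewrite divr_gt0// lt_min d10.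
exists d => // z h zx hd.
have key (t : R) : 0 <= t <= 1 -> `|z + t *: (fcoord i h *: fvec i) - x| < Num.min d1 d2.
  move=> /andP[t0 t1]; rewrite addrAC -dC mulrDr mulr1.
  apply: le_lt_trans (ler_normD _ _) _; apply: ltr_leD => //.
  rewrite !normrZ (ger0_norm t0) mulrA; apply: ler_wpM2r => //.
  rewrite -[d]mul1r; apply: ler_pM => //.
  by apply: le_trans (fcoord_le _ _) (ltW hd).
have key' : `|z + fcoord i h *: fvec i - x| < Num.min d1 d2.
  by have := key 1; rewrite scale1r; apply; rewrite ler01 lexx.
have hd1 : `|h| < d1.
  apply: lt_le_trans hd _; rewrite /d ler_pdivrMr//.
  by rewrite ge_min ler_peMr// ltW.
have /IH /(_ hd1) {}IH : `|z + fcoord i h *: fvec i - x| < d1.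
  by apply: lt_le_trans key' _; rewrite ge_min lexx.
have B2 (t : R) : 0 <= t <= 1 -> ball x d2 (z + t *: (fcoord i h *: fvec i)).
  move=> /key k; rewrite -ball_normE/= distrC.
  by apply: lt_le_trans k _; rewrite ge_min lexx orbT.
have [t t01 E] : exists2 t : R, 0 < t < 1 &
    f (z + fcoord i h *: fvec i) - f z =
    'D_(fcoord i h *: fvec i) f (z + t *: (fcoord i h *: fvec i)).
  by apply: mvt_line => t /B2 /H2[].
have t01' : 0 <= t <= 1 by case/andP: t01 => ? ?; rewrite !ltW.
have [dt et] := H2 _ (B2 _ t01').
rewrite (@derive_val _ _ _ _ _ _ _ (is_derive_scale (fcoord i h) (dt (fvec i)))) in E.
rewrite !big_cons.
(* The step along [i] is taken before the others: the induction hypothesis applies at the displaced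
   point, and the step itself is controlled by the mean value theorem. *)
rewrite (_ : _ - _ = (f (z + fcoord i h *: fvec i + \sum_(j <- s) fcoord j h *: fvec j) -
    f (z + fcoord i h *: fvec i) - \sum_(j <- s) fcoord j h * 'D_(fvec j) f x) +
    ((f (z + fcoord i h *: fvec i) - f z) - fcoord i h * 'D_(fvec i) f x)); last first.
  by rewrite !addrA -![_ - _ - _ + _]addrA; set a := f _; set b := f _; set c := f _; lra.
rewrite E.
apply: le_trans (ler_normD _ _) _.
rewrite [size _]/= -addn1 natrD !mulrDl mul1r; apply: lerD => //.
rewrite -mulrBr normrM mulrC; apply: ler_pM => //.
  by rewrite distrC ltW.
exact: fcoord_le.
Qed.

(** Strict differentiability over all basis directions, based at [x] itself; the candidate
    differential is the linear form whose coefficients are the derivatives along the basis. *)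
Lemma C1_differentiable (f : V -> R) (x : V) :
  (\forall z \near x, forall v, derivable f z v) ->
  (forall v, {for x, continuous ('D_v f)}) -> differentiable f x.
Proof.
move=> df cf.
pose L (h : V) : R := \sum_(i < @fdim R V fV) fcoord i h * 'D_(fvec i) f x.
have L_lin : linear L.
  move=> a u v; rewrite /L scaler_sumr -big_split/=; apply: eq_bigr => i _.
  by rewrite fcoord_lin mulrDl -mulrA.
pose LM := GRing.isLinear.Build _ _ _ _ _ L_lin.
pose LL : {linear V -> R} := HB.pack L LM.
have LC : continuous LL.
  move=> y; rewrite /LL/= /L; apply: cvg_bigsum => i.
  by apply: cvgM; [exact: fcoord_continuous | exact: cvg_cst].
have H : f \o shift x = cst (f x) + LL +o_ 0 id.
  apply/eqaddoP => e e0.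
  (* The error grows with the number of directions; adding 1 keeps the denominator positive in
     dimension 0. *)
  pose e' := e / ((@fdim R V fV)%:R + 1).
  have N0 : 0 < (@fdim R V fV)%:R + 1 :> R by rewrite ltr_wpDl.
  have e'0 : 0 < e' by rewrite divr_gt0.
  have [d d0 Hd] := C1_strictly_differentiable (index_enum 'I_(@fdim R V fV)) df cf e'0.
  near=> h.
  have hd : `|h| < d by near: h; apply: nbhs0_lt.
  have := Hd x h; rewrite subrr normr0 -fcoordE => /(_ d0 hd) H.
  rewrite -![(_ - _ : _ -> _) _]/(_ - _) -![(_ + _ : _ -> _) _]/(_ + _) /=.
  rewrite opprD addrA [h + x]addrC.
  apply: le_trans H _; apply: ler_wpM2r => //.
  rewrite /e' mulrCA -[leRHS]mulr1 ler_pM2l//.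
  rewrite ler_pdivrMr// mul1r.
  rewrite /index_enum; case: index_enum_key => /=.
  by rewrite -enumT size_enum_ord lerDl.
have dE := diff_unique LC H.
by apply/diff_locallyP; rewrite dE.
Unshelve. all: by end_near. Qed.

End C1.

(** * Symmetry of mixed second derivatives *)

Section schwarz.
Variables (R : realType) (V : normedModType R).

Lemma is_derive_shiftr (W : normedModType R) (f : V -> W) (a x v : V) :
  derivable f (x + a) v ->
  is_derive x v (fun z => f (z + a)) ('D_v f (x + a)).
Proof.
have E : (fun h => h^-1 *: (((fun z => f (z + a)) \o shift x) (h *: v) - f (x + a)))
  = (fun h => h^-1 *: ((f \o shift (x + a)) (h *: v) - f (x + a))).
  by apply/funext => h /=; rewrite addrA.
by move=> df; split; rewrite /derivable /derive E.
Qed.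

(** The mean value theorem is applied twice: to z -> f(z + h v) - f(z) along h u, then to ['D_u f]
    along h v. *)
Lemma second_difference (f : V -> R) (x u v : V) (h : R) :
  (forall s t : R, 0 <= s <= 1 -> 0 <= t <= 1 ->
     derivable f (x + s *: (h *: u) + t *: (h *: v)) u /\
     derivable ('D_u f) (x + s *: (h *: u) + t *: (h *: v)) v) ->
  exists s t : R, [/\ 0 <= s <= 1, 0 <= t <= 1 &
    f (x + h *: u + h *: v) - f (x + h *: u) - (f (x + h *: v) - f x) =
    h ^+ 2 * 'D_v ('D_u f) (x + s *: (h *: u) + t *: (h *: v))].
Proof.
move=> H.
pose phi z := f (z + h *: v) - f z.
have dphi (s : R) : 0 <= s <= 1 ->
   is_derive (x + s *: (h *: u)) (h *: u) phi
    (h * ('D_u f (x + s *: (h *: u) + h *: v) - 'D_u f (x + s *: (h *: u)))).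
  move=> s01.
  have [H0 _] := H s 0 s01 ltac:(by rewrite lexx ler01).
  have [H1 _] := H s 1 s01 ltac:(by rewrite lexx ler01).
  rewrite scale0r addr0 in H0; rewrite scale1r in H1.
  have D0 := is_derive_scale h H0.
  have D1 := is_derive_shiftr H1.
  have D1' := is_derive_scale h (@ex_derive _ _ _ _ _ _ _ D1).
  rewrite (@derive_val _ _ _ _ _ _ _ D1) in D1'.
  by rewrite mulrBr; apply: is_deriveB.
have [s s01 E] : exists2 s : R, 0 < s < 1 &
    phi (x + h *: u) - phi x = 'D_(h *: u) phi (x + s *: (h *: u)).
  by apply: mvt_line => s /dphi ds; exact: (@ex_derive _ _ _ _ _ _ _ ds).
have s01' : 0 <= s <= 1 by case/andP: s01 => ? ?; rewrite !ltW.
have [t t01 E'] : exists2 t : R, 0 < t < 1 &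
    'D_u f (x + s *: (h *: u) + h *: v) - 'D_u f (x + s *: (h *: u)) =
    'D_(h *: v) ('D_u f) (x + s *: (h *: u) + t *: (h *: v)).
  apply: (mvt_line (f := 'D_u f)) => t t01; have [_ Ht] := H s t s01' t01.
  by have dH := is_derive_scale h Ht; exact: (@ex_derive _ _ _ _ _ _ _ dH).
have t01' : 0 <= t <= 1 by case/andP: t01 => ? ?; rewrite !ltW.
exists s, t; split => //.
rewrite -[LHS]/(phi (x + h *: u) - phi x) E.
rewrite (@derive_val _ _ _ _ _ _ _ (dphi s s01')) E'.
have [_ Ht] := H s t s01' t01'.
rewrite (@derive_val _ _ _ _ _ _ _ (is_derive_scale h Ht)).
by rewrite expr2 -mulrA.
Qed.

(** The second difference over the parallelogram with sides h u and h v is symmetric in [u] and [v].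
    Its two mean value forms equate the two mixed derivatives at two points near [x], and continuity
    puts each within e / 2 of its value at [x]. *)
Lemma schwarz (f : V -> R) (x u v : V) :
  (\forall y \near x, [/\ derivable f y u, derivable f y v,
     derivable ('D_u f) y v & derivable ('D_v f) y u]) ->
  {for x, continuous ('D_v ('D_u f))} ->
  {for x, continuous ('D_u ('D_v f))} ->
  'D_v ('D_u f) x = 'D_u ('D_v f) x.
Proof.
move=> df c1 c2; apply/eqP; rewrite -subr_eq0 -normr_le0; apply/ler_addgt0Pr => e e0.
rewrite add0r.
have near_le (a b c : R) : `|a - c| < e / 2 -> `|b - c| < e / 2 -> `|a - b| <= e.
  move=> ac bc; rewrite (_ : a - b = (a - c) - (b - c)); last by lra.
  rewrite (splitr e); apply: le_trans (ler_normB _ _) _.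
  by apply: lerD; apply: ltW.
have e20 : 0 < e / 2 by rewrite divr_gt0.
have /cvgrPdist_lt c1' := c1; have /cvgrPdist_lt c2' := c2.
have /(@nbhs_ballP R V) [d /= d0 H] : \forall y \near x,
  [/\ [/\ derivable f y u, derivable f y v,
     derivable ('D_u f) y v & derivable ('D_v f) y u],
     `|'D_v ('D_u f) x - 'D_v ('D_u f) y| < e / 2 &
     `|'D_u ('D_v f) x - 'D_u ('D_v f) y| < e / 2].
  apply: filterS (filterI (filterI df (c1' _ e20)) (c2' _ e20)) => y [[h1 h2] h3].
  exact: And3 h1 h2 h3.
(* With d = h * C the parallelogram stays in the ball of radius d; the summand 1 makes C positive
   even for u = v = 0 and the containment strict. *)
pose C := `|u| + `|v| + 1.
have C0 : 0 < C by rewrite ltr_wpDl// addr_ge0.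
have [h h0 dE] : exists2 h : R, 0 < h & d = h * C.
  by exists (d / C); [rewrite divr_gt0|rewrite divfK// gt_eqF].
have B (a b : V) (s t : R) : `|a| + `|b| < C -> 0 <= s <= 1 -> 0 <= t <= 1 ->
    ball x d (x + s *: (h *: a) + t *: (h *: b)).
  move=> ab /andP[s0 s1] /andP[t0 t1].
  rewrite -ball_normE/= !opprD !addrA subrr add0r -opprD normrN.
  apply: le_lt_trans (ler_normD _ _) _.
  rewrite dE.
  apply: (@le_lt_trans _ _ (h * (`|a| + `|b|))); last by rewrite ltr_pM2l.
  rewrite mulrDr !normrZ (gtr0_norm h0) (ger0_norm s0) (ger0_norm t0).
  by apply: lerD; apply: ler_piMl => //; rewrite mulr_ge0// ltW.
have uvC : `|u| + `|v| < C by rewrite ltrDl.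
have vuC : `|v| + `|u| < C by rewrite addrC.
have [s [t [s01 t01 E1]]] : exists s t : R, [/\ 0 <= s <= 1, 0 <= t <= 1 &
    f (x + h *: u + h *: v) - f (x + h *: u) - (f (x + h *: v) - f x) =
    h ^+ 2 * 'D_v ('D_u f) (x + s *: (h *: u) + t *: (h *: v))].
  apply: second_difference => s t s01 t01.
  by have [[]] := H _ (B u v s t uvC s01 t01).
have [s' [t' [s01' t01' E2]]] : exists s t : R, [/\ 0 <= s <= 1, 0 <= t <= 1 &
    f (x + h *: v + h *: u) - f (x + h *: v) - (f (x + h *: u) - f x) =
    h ^+ 2 * 'D_u ('D_v f) (x + s *: (h *: v) + t *: (h *: u))].
  apply: second_difference => s' t' s01' t01'.
  by have [[]] := H _ (B v u s' t' vuC s01' t01').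
have E : 'D_v ('D_u f) (x + s *: (h *: u) + t *: (h *: v)) =
   'D_u ('D_v f) (x + s' *: (h *: v) + t' *: (h *: u)).
  apply: (@mulfI _ (h ^+ 2)); first by rewrite expf_neq0// gt_eqF.
  rewrite [x + h *: v + h *: u]addrAC in E2.
  have swap (w1 w2 w3 w4 : R) : w1 - w2 - (w3 - w4) = w1 - w3 - (w2 - w4) by ring.
  exact: etrans (esym E1) (etrans (swap _ _ _ _) E2).
have [_ A1 _] := H _ (B u v s t uvC s01 t01).
have [_ _ A2] := H _ (B v u s' t' vuC s01' t01').
rewrite -E in A2.
exact: near_le A1 A2.
Qed.

End schwarz.

(** * Chain rule for directional derivatives *)

Section chain.
Variable R : realType.

Lemma is_derive1P (V W : normedModType R) (f : V -> W) (x v : V) (l : W) :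
  is_derive x v f l <-> is_derive (0 : R) 1 (fun h : R => f (h *: v + x)) l.
Proof.
have E : (fun h : R => h^-1 *: (((fun t => f (t *: v + x)) \o shift 0) (h *: (1:R)) - f
  (0 *: v + x)))
  = (fun h => h^-1 *: ((f \o shift x) (h *: v) - f x)).
  by apply/funext => h /=; rewrite addr0 scale0r add0r [h *: 1]mulr1.
by split=> -[d e]; split; move: d e; rewrite /derivable /derive E.
Qed.

(** The inner map is restricted to the line through [x] in direction [v], where it becomes a curve;
    derivable and differentiable coincide for curves, so the usual chain rule applies. *)
Lemma is_derive_comp (V W Z : normedModType R) (g : V -> W) (f : W -> Z)
    (x v : V) (l : W) :
  is_derive x v g l -> differentiable f (g x) ->
  is_derive x v (fun y => f (g y)) ('D_l f (g x)).
Proof.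
move=> /is_derive1P[gd gl] fd; apply/is_derive1P.
have gd' : differentiable (fun h : R => g (h *: v + x)) 0 by apply/derivable1_diffP.
have fd' : differentiable f (g ((0 : R) *: v + x)) by rewrite scale0r add0r.
have D : differentiable (f \o (fun h : R => g (h *: v + x))) 0.
  exact: differentiable_comp.
split; first exact: diff_derivable.
rewrite -[LHS]/('D_1 (f \o (fun h : R => g (h *: v + x))) 0).
have gl' : 'd (fun h : R => g (h *: v + x)) 0 1 = l by rewrite -deriveE.
by rewrite deriveE// diff_comp//= gl' scale0r add0r deriveE.
Qed.

Lemma derive_sum_dir (V W : normedModType R) (f : V -> W) (x : V) (I : Type)
    (r : seq I) (c : I -> R) (e : I -> V) : differentiable f x ->
  'D_(\sum_(i <- r) c i *: e i) f x = \sum_(i <- r) c i *: 'D_(e i) f x.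
Proof.
move=> fd; rewrite deriveE// linear_sum; apply: eq_bigr => i _.
by rewrite linearZ/= deriveE.
Qed.

Lemma deriveD_dir (V W : normedModType R) (f : V -> W) (x u v : V) :
  differentiable f x -> 'D_(u + v) f x = 'D_u f x + 'D_v f x.
Proof. by move=> fd; rewrite !deriveE// linearD. Qed.

Lemma deriveZ_dir (V W : normedModType R) (f : V -> W) (x v : V) (a : R) :
  differentiable f x -> 'D_(a *: v) f x = a *: 'D_v f x.
Proof. by move=> fd; rewrite !deriveE// linearZ. Qed.

Lemma derive_fvec (V : normedModType R) (fV : finite_dim V) (f : V -> R) (x v : V) :
  differentiable f x ->
  'D_v f x = \sum_i fcoord i v * 'D_(fvec i) f x.
Proof. by move=> fd; rewrite {1}(fcoordE v) derive_sum_dir. Qed.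

End chain.

(** * Smooth functions *)

Section smooth.
Variables (R : realType) (V W : normedModType R).
Implicit Types (U : set V) (f g : V -> W).

Lemma iter_derive_rcons (vs : seq V) (v : V) f :
  iter_derive (rcons vs v) f = iter_derive vs ('D_v f).
Proof. by elim: vs => //= w vs ->. Qed.

Lemma smooth_derive U f v : smooth_on U f -> smooth_on U ('D_v f).
Proof. by move=> sf vs x Ux; rewrite -iter_derive_rcons; exact: sf. Qed.

Lemma smooth_continuous U f x : smooth_on U f -> U x -> {for x, continuous f}.
Proof. by move=> sf Ux; have [] := sf [::] x Ux. Qed.

Lemma smooth_derivable U f x v : smooth_on U f -> U x -> derivable f x v.
Proof. by move=> sf Ux; have [_ /(_ v)] := sf [::] x Ux. Qed.

Lemma smooth_subset U U' f : U' `<=` U -> smooth_on U f -> smooth_on U' f.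
Proof. by move=> UU sf vs x /UU Ux; exact: sf. Qed.

Lemma smooth_bigcup (I : Type) (F : I -> set V) U f :
  (forall x, U x -> exists2 i, F i x & smooth_on (F i) f) -> smooth_on U f.
Proof. by move=> H vs x /H[i Fx sf]; exact: sf. Qed.

Lemma eq_iter_derive U f g : open U -> (forall x, U x -> f x = g x) ->
  forall vs x, U x -> iter_derive vs f x = iter_derive vs g x.
Proof.
move=> oU fg; elim=> [|v vs IH] x Ux /=; first exact: fg.
by apply: near_eq_derive; apply: filterS (open_near oU Ux) => y; exact: IH.
Qed.

Lemma eq_smooth U f g : open U -> (forall x, U x -> f x = g x) ->
  smooth_on U f -> smooth_on U g.
Proof.
move=> oU fg sf vs x Ux; have [fc fd] := sf vs x Ux.
have E := eq_iter_derive oU fg vs.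
have nE : {near x, iter_derive vs f =1 iter_derive vs g}.
  by apply: filterS (open_near oU Ux).
split; last by move=> v; exact: near_eq_derivable (fd v).
rewrite /prop_for/continuous_at -(E _ Ux).
apply: cvg_trans fc; apply: near_eq_cvg; exact: nE.
Qed.

End smooth.

(* [smooth_on U] is the largest class of functions that are continuous and
   derivable on [U] and whose derivatives agree on [U] with members of the class. *)
Section smooth_coinduction.
Variables (R : realType) (V : normedModType R) (U : set V).
Hypothesis oU : open U.

Definition derivable_on (f : V -> R) := forall x, U x ->
  {for x, continuous f} /\ forall v, derivable f x v.

Lemma smooth_coinduction (P : (V -> R) -> Prop) :
  (forall f, P f -> derivable_on f /\
     forall v, exists2 g, P g & forall x, U x -> 'D_v f x = g x) ->
  forall f, P f -> smooth_on U f.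
Proof.
move=> HP f Pf.
have H vs : exists2 g, P g & forall x, U x -> iter_derive vs f x = g x.
  elim: vs => [|v vs [g Pg IH]]; first by exists f.
  have [_ /(_ v)[g' Pg' E]] := HP g Pg.
  exists g' => // x Ux /=; rewrite -E//.
  by apply: near_eq_derive; apply: filterS (open_near oU Ux).
move=> vs x Ux; have [g Pg E] := H vs.
have [/(_ x Ux)[gc gd] _] := HP g Pg.
have nE : {near x, g =1 iter_derive vs f}.
  by apply: filterS (open_near oU Ux) => y Uy; rewrite E.
split; last by move=> v; exact: near_eq_derivable (gd v).
rewrite /prop_for/continuous_at (E _ Ux).
apply: cvg_trans gc; apply: near_eq_cvg; exact: nE.
Qed.

Variable B : (V -> R) -> Prop.

(** The candidate class for coinduction: by the Leibniz and quotient rules it is stable under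
    derivation as soon as the derivatives of its generators lie in it. *)
Inductive algebra_over : (V -> R) -> Prop :=
| alg_base f : B f -> algebra_over f
| alg_cst c : algebra_over (cst c)
| alg_add f g : algebra_over f -> algebra_over g -> algebra_over (f + g)
| alg_mul f g : algebra_over f -> algebra_over g -> algebra_over (f * g)
| alg_inv f : (forall x, U x -> f x != 0) -> algebra_over f ->
    algebra_over (fun x => (f x)^-1).

Lemma smooth_algebra :
  (forall f, B f -> derivable_on f /\
     forall v, exists2 g, algebra_over g & forall x, U x -> 'D_v f x = g x) ->
  forall f, algebra_over f -> smooth_on U f.
Proof.
move=> HB; apply: smooth_coinduction => f.
elim=> {f} [f /HB//|c|f g Af [fd fD] Ag [gd gD]|f g Af [fd fD] Ag [gd gD]|f f0 Af [fd fD]].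
- split.
    by move=> x Ux; split; [exact: cvg_cst|move=> v; exact: derivable_cst].
  by move=> v; exists (cst 0); [exact: alg_cst|move=> x _; rewrite derive_cst].
- split.
    move=> x Ux; have [[fc fv] [gc gv]] := (fd x Ux, gd x Ux).
    by split; [exact: continuousD|move=> v; exact: derivableD].
  move=> v; have [[f' Af' Ef] [g' Ag' Eg]] := (fD v, gD v).
  exists (f' + g'); first exact: alg_add.
  move=> x Ux; have [[fc fv] [gc gv]] := (fd x Ux, gd x Ux).
  by rewrite deriveD// Ef// Eg.
- split.
    move=> x Ux; have [[fc fv] [gc gv]] := (fd x Ux, gd x Ux).
    by split; [exact: continuousM|move=> v; exact: derivableM].
  move=> v; have [[f' Af' Ef] [g' Ag' Eg]] := (fD v, gD v).
  exists (f * g' + g * f'); first by apply: alg_add; apply: alg_mul.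
  move=> x Ux; have [[fc fv] [gc gv]] := (fd x Ux, gd x Ux).
  by rewrite deriveM// Ef// Eg.
- split.
    move=> x Ux; have [fc fv] := fd x Ux.
    by split; [apply: continuousV => //; exact: f0|move=> v; apply: derivableV => //;
      exact: f0].
  move=> v; have [f' Af' Ef] := fD v.
  exists ((cst (-1)) * (fun x => (f x)^-1) * (fun x => (f x)^-1) * f').
    apply: alg_mul => //; apply: alg_mul; last exact: alg_inv.
    by apply: alg_mul; [exact: alg_cst|exact: alg_inv].
  move=> x Ux; have [fc fv] := fd x Ux.
  rewrite deriveV//; last exact: f0.
  rewrite Ef// -![(_ * _ : _ -> _) _]/(_ * _) /cst.
  rewrite -exprVn expr2 -[LHS]/(GRing.mul _ _).
  by rewrite mulN1r !mulNr.
Qed.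

End smooth_coinduction.

Section smooth_closure.
Variables (R : realType) (V : normedModType R) (U : set V).
Hypothesis oU : open U.
Implicit Types f g : V -> R.

Let smooth_alg f : algebra_over U (smooth_on U) f -> smooth_on U f.
Proof.
apply: smooth_algebra => // {}f sf; split.
  move=> x Ux; split; first exact: smooth_continuous Ux.
  by move=> v; exact: smooth_derivable Ux.
by move=> v; exists ('D_v f) => //; apply: alg_base; exact: smooth_derive.
Qed.

Lemma smooth_cst (c : R) : smooth_on U (cst c : V -> R).
Proof. exact/smooth_alg/alg_cst. Qed.

Lemma smoothD f g : smooth_on U f -> smooth_on U g ->
  smooth_on U (fun x => f x + g x).
Proof. by move=> sf sg; apply: smooth_alg; apply: alg_add; apply: alg_base. Qed.

Lemma smoothM f g : smooth_on U f -> smooth_on U g ->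
  smooth_on U (fun x => f x * g x).
Proof. by move=> sf sg; apply: smooth_alg; apply: alg_mul; apply: alg_base. Qed.

Lemma smoothV f : (forall x, U x -> f x != 0) -> smooth_on U f ->
  smooth_on U (fun x => (f x)^-1).
Proof. by move=> f0 sf; apply: smooth_alg; apply: alg_inv => //; apply: alg_base. Qed.

Lemma smoothN f : smooth_on U f -> smooth_on U (fun x => - f x).
Proof.
move=> sf; under eq_fun do rewrite -mulN1r.
exact: (smoothM (@smooth_cst (-1)) sf).
Qed.

Lemma smoothB f g : smooth_on U f -> smooth_on U g ->
  smooth_on U (fun x => f x - g x).
Proof. by move=> sf sg; exact: smoothD sf (smoothN sg). Qed.

Lemma smooth_sum (I : Type) (r : seq I) (P : pred I) (F : I -> V -> R) :
  (forall i, smooth_on U (F i)) ->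
  smooth_on U (fun x => \sum_(i <- r | P i) F i x).
Proof.
move=> sF; elim: r => [|i r IH].
  by under eq_fun do rewrite big_nil; exact: smooth_cst.
under eq_fun do rewrite big_cons; case: (P i); last exact: IH.
exact: smoothD (sF i) IH.
Qed.

Lemma smooth_prod (I : Type) (r : seq I) (F : I -> V -> R) :
  (forall i, smooth_on U (F i)) ->
  smooth_on U (fun x => \prod_(i <- r) F i x).
Proof.
move=> sF; elim: r => [|i r IH].
  by under eq_fun do rewrite big_nil; exact: smooth_cst.
by under eq_fun do rewrite big_cons; exact: smoothM (sF i) IH.
Qed.

Context {fV : finite_dim V}.

Lemma smooth_differentiable f x : smooth_on U f -> U x -> differentiable f x.
Proof.
move=> sf Ux; apply: C1_differentiable.
  by apply: filterS (open_near oU Ux) => y Uy v; exact: smooth_derivable Uy.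
by move=> v; apply: smooth_continuous Ux; exact: smooth_derive.
Qed.

Lemma derive_comm f x u v : smooth_on U f -> U x ->
  'D_v ('D_u f) x = 'D_u ('D_v f) x.
Proof.
move=> sf Ux; apply: schwarz.
- apply: filterS (open_near oU Ux) => y Uy.
  have H1 := smooth_derivable (v := u) sf Uy.
  have H2 := smooth_derivable (v := v) sf Uy.
  have H3 := smooth_derivable (v := v) (smooth_derive u sf) Uy.
  have H4 := smooth_derivable (v := u) (smooth_derive v sf) Uy.
  exact: And4 H1 H2 H3 H4.
- exact: smooth_continuous (smooth_derive v (smooth_derive u sf)) Ux.
- exact: smooth_continuous (smooth_derive u (smooth_derive v sf)) Ux.
Qed.

End smooth_closure.

Section smooth_composition.
Variables (R : realType) (V W : normedModType R).
Context {fW : finite_dim W}.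

Lemma smooth_fcoord (U : set V) (f : V -> W) : open U ->
  (forall i : 'I_(@fdim R W fW), smooth_on U (fun x => fcoord i (f x))) <->
  smooth_on U f.
Proof.
move=> oU; split=> sf.
  (* Iterated derivatives are taken coordinatewise. The identity holds on the open set [U], hence
     near each of its points, which is enough to differentiate it again. *)
  have E vs x : U x -> iter_derive vs f x =
      \sum_(i < @fdim R W fW) (iter_derive vs (fun x => fcoord i (f x)) x : R) *: fvec i.
    elim: vs x => [|v vs IH] x Ux; first exact: fcoordE.
    have d (i : 'I_(@fdim R W fW)) :
        derivable (iter_derive vs (fun x => fcoord i (f x))) x v.
      by have [_] := sf i vs x Ux; exact.
    apply: derive_val; apply: (@near_eq_is_derive _ _ _
      (fun x => \sum_(i < @fdim R W fW) (iter_derive vs (fun x => fcoord i (f x)) x : R)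
        *: fvec i)).
      by apply: filterS (open_near oU Ux) => y /IH.
    apply/(is_derive_fcoord (fV := fW)) => i.
    rewrite fcoord_vec_sum.
    under eq_fun do rewrite fcoord_vec_sum.
    exact: derivableP.
  have Ei vs x i : U x -> fcoord i (iter_derive vs f x) =
      iter_derive vs (fun x => fcoord i (f x)) x.
    move=> Ux; rewrite E//.
    exact: (fcoord_vec_sum (fun j => iter_derive vs (fun x => fcoord j (f x)) x)).
  move=> vs x Ux; split.
    apply: (continuous_fcoord (fV := fW)) => i; have [+ _] := sf i vs x Ux.
    rewrite /prop_for/continuous_at -Ei// => c.
    apply: cvg_trans c; apply: near_eq_cvg.
    by apply: filterS (open_near oU Ux) => y Uy; rewrite Ei.
  move=> v; apply/(derivable_fcoord (fV := fW)) => i.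
  have [_ /(_ v)] := sf i vs x Ux.
  apply: near_eq_derivable.
  by apply: filterS (open_near oU Ux) => y Uy; rewrite Ei.
move=> i.
have Ei vs x : U x -> iter_derive vs (fun x => fcoord i (f x)) x =
    fcoord i (iter_derive vs f x).
  elim: vs x => [//|v vs IH] x Ux /=.
  have [_ /(_ v) d] := sf vs x Ux.
  rewrite -derive_fcoord//; apply: near_eq_derive.
  by apply: filterS (open_near oU Ux) => y /IH.
move=> vs x Ux; have [c d] := sf vs x Ux; split.
  rewrite /prop_for/continuous_at Ei//.
  have c' : {for x, continuous (fun y => fcoord i (iter_derive vs f y))}.
    by apply: continuous_comp => //; exact: fcoord_continuous.
  apply: cvg_trans c'; apply: near_eq_cvg.
  by apply: filterS (open_near oU Ux) => y Uy; rewrite Ei.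
move=> v; move/derivable_fcoord/(_ i): (d v); apply: near_eq_derivable.
by apply: filterS (open_near oU Ux) => y Uy; rewrite Ei.
Qed.

Variables (U : set V) (U' : set W) (g : V -> W) (f : W -> R).
Hypotheses (oU : open U) (oU' : open U') (sg : smooth_on U g)
  (gU : forall x, U x -> U' (g x)).

(** The derivative of a composite is a sum of products of coordinates of ['D_v g] with composites of
    [g]. Composites alone are thus not stable under derivation, but the algebra generated by them
    and by the smooth functions on [U] is. *)
Lemma smooth_comp : smooth_on U' f -> smooth_on U (fun x => f (g x)).
Proof.
move=> sf.
pose B h := smooth_on U h \/ exists2 f' : W -> R, smooth_on U' f' & h = fun x => f' (g x).
suff H h : algebra_over U B h -> smooth_on U h.
  by apply: H; apply: alg_base; right; exists f.
apply: smooth_algebra => // {}h [sh|[f' sf' ->]].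
  split.
    move=> x Ux; split; first exact: smooth_continuous Ux.
    by move=> v; exact: smooth_derivable Ux.
  move=> v; exists ('D_v h) => //; apply: alg_base; left; exact: smooth_derive.
have D x v : U x -> is_derive x v (fun x => f' (g x)) ('D_('D_v g x) f' (g x)).
  move=> Ux; apply: is_derive_comp.
    by apply/derivableP; exact: smooth_derivable Ux.
  by apply: (smooth_differentiable oU' sf'); exact: gU.
split.
  move=> x Ux; split; last by move=> v; exact: (@ex_derive _ _ _ _ _ _ _ (D x v Ux)).
  apply: (@continuous_comp _ _ _ g f'); first exact: smooth_continuous Ux.
  by apply: (smooth_continuous sf'); exact: gU.
move=> v; exists (\sum_(i < @fdim R W fW)
   (fun x => fcoord i ('D_v g x)) * (fun x => 'D_(fvec i) f' (g x))).
  elim/big_ind: _ => [|a b|i _]; [exact: alg_cst|exact: alg_add|].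
  apply: alg_mul; apply: alg_base; [left|right].
    by apply: ((smooth_fcoord _ oU).2 _ i); exact: smooth_derive.
  by exists ('D_(fvec i) f'); first exact: smooth_derive.
move=> x Ux; rewrite (@derive_val _ _ _ _ _ _ _ (D x v Ux)) derive_fvec.
  by rewrite fct_sumE.
by apply: (smooth_differentiable oU' sf'); exact: gU.
Qed.

End smooth_composition.

Lemma smooth_comp_vec (R : realType) (V W Z : normedModType R)
    {fW : finite_dim W} {fZ : finite_dim Z}
    (U : set V) (U' : set W) (g : V -> W) (f : W -> Z) :
  open U -> open U' -> smooth_on U g -> (forall x, U x -> U' (g x)) ->
  smooth_on U' f -> smooth_on U (fun x => f (g x)).
Proof.
move=> oU oU' sg gU sf; apply/(smooth_fcoord (fW := fZ)) => // i.
apply: (smooth_comp oU oU' sg gU (f := fun y => fcoord i (f y))).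
by move: i; apply/smooth_fcoord.
Qed.

Lemma smooth_coord (R : realType) (V : normedModType R) {fV : finite_dim V} (U : set V) i :
  smooth_on U (fcoord i : V -> R).
Proof.
move=> vs; elim/last_ind: vs => [|vs v _] y Uy.
  split; first exact: fcoord_continuous.
  by move=> v; exact: (@ex_derive _ _ _ _ _ _ _ (is_derive_coord i y v)).
rewrite iter_derive_rcons (_ : 'D_v (fcoord i) = cst (fcoord i v)).
  exact: (@smooth_cst R V setT openT _ vs y Logic.I).
apply/funext => z.
exact: (@derive_val _ _ _ _ _ _ _ (is_derive_coord i z v)).
Qed.

(* The functions [p \o w] with [p] smooth are stable under derivation:
   [(p \o w)' = (dp f) \o w]. *)
Lemma smooth_ode (R : realType) (V : normedModType R) {fV : finite_dim V}
    (O : set R) (U : set V) (w : R -> V) (f : V -> V) :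
  open O -> open U -> smooth_on U f -> (forall t, O t -> U (w t)) ->
  (forall t, O t -> is_derive t 1 w (f (w t))) -> smooth_on O w.
Proof.
move=> oO oU sf wU dw.
pose P h := exists2 p : V -> R, smooth_on U p & h = fun t => p (w t).
have wc t : O t -> {for t, continuous w}.
  move=> /dw d; apply: differentiable_continuous; apply/derivable1_diffP.
  exact: (@ex_derive _ _ _ _ _ _ _ d).
have HP h : P h -> smooth_on O h.
  apply: smooth_coinduction => // {}h [p sp ->].
  have D t v : O t -> is_derive t v (fun t => p (w t)) (v * 'D_(f (w t)) p (w t)).
    move=> Ot.
    have D1 : is_derive t 1 (fun t => p (w t)) ('D_(f (w t)) p (w t)).
      apply: is_derive_comp; first exact: dw.
      by apply: (smooth_differentiable oU sp); exact: wU.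
    have := is_derive_scale v (@ex_derive _ _ _ _ _ _ _ D1).
    by rewrite [v *: 1]mulr1 (@derive_val _ _ _ _ _ _ _ D1).
  split.
    move=> t Ot; split; last by move=> v; exact: (@ex_derive _ _ _ _ _ _ _ (D t v Ot)).
    apply: (@continuous_comp _ _ _ w p); first exact: wc.
    by apply: (smooth_continuous sp); exact: wU.
  move=> v; exists (fun t => v * \sum_(i < @fdim R V fV)
      fcoord i (f (w t)) * 'D_(fvec i) p (w t)).
    exists (fun y => v * \sum_(i < @fdim R V fV) fcoord i (f y) * 'D_(fvec i) p y);
      last by [].
    apply: (smoothM oU (smooth_cst oU v)).
    apply: (smooth_sum oU) => i.
    apply: (smoothM oU _ (smooth_derive (fvec i) sp)).
    by move: i; apply/smooth_fcoord.
  move=> t Ot; rewrite (@derive_val _ _ _ _ _ _ _ (D t v Ot)); congr (_ * _).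
  by apply: derive_fvec; apply: (smooth_differentiable oU sp); exact: wU.
apply/(smooth_fcoord (fW := fV)) => // i; apply: HP; exists (fcoord i) => //.
exact: smooth_coord.
Qed.

(** * Ordinary differential equations *)

Section antiderivative.
Variable R : realType.

Lemma continuous_antiderivative (g : R -> R) (a b : R) : continuous g ->
  exists G : R -> R, forall t : R, a < t < b -> is_derive t 1 G (g t).
Proof.
move=> cg; exists (fun x => \int[lebesgue_measure]_(t in [set` `[a, x]]) (g t))%R.
move=> t /andP[at_ tb].
have ig : (@lebesgue_measure R).-integrable `[a, b] (EFin \o g).
  apply: continuous_compact_integrable; first exact: segment_compact.
  exact: continuous_subspaceT.
have [d e] := continuous_FTC1_closed tb ig at_ (cg t).
by apply: DeriveDef; [exact: d|rewrite -derive1E; exact: e].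
Qed.

Lemma near_norm_lt (t d : R) : `|t| < d -> \forall s \near t, `|s| < d.
Proof.
move=> td; have dt : 0 < d - `|t| by rewrite subr_gt0.
near=> s; rewrite -(subKr t s); apply: le_lt_trans (ler_normB _ _) _.
by rewrite -ltrBrDl; near: s; exact: cvgr_dist_lt.
Unshelve. all: by end_near. Qed.

(** The projection of the line onto [-r, r] when 0 <= r. It serves to extend a function from an
    interval to a continuous function on the line, and to truncate a vector field to a box. *)
Definition clamp (r a : R) := Num.max (- r) (Num.min r a).

Let max_lipschitz (c a b : R) : `|Num.max c a - Num.max c b| <= `|a - b|.
Proof.
rewrite ler_norml; have [h1|h1] := leP c a; have [h2|h2] := leP c b;
  by apply/andP; split; case: (ger0P (a - b)) => ?; lra.
Qed.

Let min_lipschitz (c a b : R) : `|Num.min c a - Num.min c b| <= `|a - b|.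
Proof.
rewrite ler_norml; have [h1|h1] := leP c a; have [h2|h2] := leP c b;
  by apply/andP; split; case: (ger0P (a - b)) => ?; lra.
Qed.

Lemma clamp_lipschitz r a b : `|clamp r a - clamp r b| <= `|a - b|.
Proof. exact: le_trans (max_lipschitz _ _ _) (min_lipschitz _ _ _). Qed.

Lemma clamp_le r a : 0 <= r -> `|clamp r a| <= r.
Proof.
move=> r0; rewrite /clamp ler_norml le_max lexx/= ge_max.
by rewrite ge_min lexx andbT (le_trans _ r0)// oppr_le0.
Qed.

Lemma clamp_id r a : `|a| <= r -> clamp r a = a.
Proof.
rewrite ler_norml => /andP[h1 h2]; rewrite /clamp.
by rewrite (min_r h2) (max_r h1).
Qed.

Lemma clamp_continuous r : continuous (clamp r).
Proof.
move=> a; apply/cvgrPdist_lt => e e0; near=> b.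
apply: le_lt_trans (clamp_lipschitz _ _ _) _; near: b.
exact: cvgr_dist_lt.
Unshelve. all: by end_near. Qed.

End antiderivative.

(** * Picard iteration for a Lipschitz field *)

Section picard.
Context {R : realType} {V : normedModType R} {fV : finite_dim V}.

Lemma norm_le_fcoord (v : V) (e : R) :
  (forall i : 'I_(@fdim R V fV), `|fcoord i v| <= e) ->
  `|v| <= e * (\sum_(i < @fdim R V fV) `|fvec i|).
Proof.
move=> H; rewrite [in leLHS](fcoordE v) mulr_sumr.
apply: le_trans (ler_norm_sum _ _ _) _; apply: ler_sum => i _.
by rewrite normrZ ler_wpM2r.
Qed.

(** The cost of passing from coordinate bounds to a bound on the norm; the summand 1 keeps it
    positive in dimension 0. *)
Let B : R := 1 + \sum_(i < @fdim R V fV) `|fvec i : V|.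

Let B1 : 1 <= B. Proof. by rewrite lerDl sumr_ge0. Qed.

Let B0 : 0 < B. Proof. exact: lt_le_trans ltr01 B1. Qed.

Lemma norm_le_fcoord_bound (v : V) (e : R) : 0 <= e ->
  (forall i : 'I_(@fdim R V fV), `|fcoord i v| <= e) -> `|v| <= e * B.
Proof.
move=> e0 /norm_le_fcoord H; apply: le_trans H _.
by rewrite ler_wpM2l// lerDr.
Qed.

(** The mean value theorem requires real values, so it is applied to each coordinate, at the cost of
    the factor [B]. Continuity of [G] carries the bound to the ends of the interval, where no
    derivative is assumed. *)
Lemma mean_value_inequality (G g : R -> V) (d m : R) : 0 <= m ->
  continuous G ->
  (forall t : R, `|t| < d -> is_derive t 1 G (g t)) ->
  (forall t : R, `|t| < d -> `|g t| <= m) ->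
  forall t : R, `|t| <= d -> `|G t - G 0| <= d * m * B.
Proof.
move=> m0 cG dG gm t td.
have d0 : 0 <= d by apply: le_trans td.
apply: norm_le_fcoord_bound; first by rewrite mulr_ge0.
move=> i; rewrite fcoordB.
have cGi : continuous (fun t => fcoord i (G t)).
  by move=> s; apply: continuous_comp; [exact: cG|exact: fcoord_continuous].
have dGi (s : R) : `|s| < d -> is_derive s 1 (fun t => fcoord i (G t)) (fcoord i (g s)).
  by move=> /dG; move/(is_derive_fcoord (fV := fV)).
have gmi (s : R) : `|s| < d -> `|fcoord i (g s)| <= m.
  by move=> /gm; apply: le_trans; exact: fcoord_le.
have n0d : `|0 : R| <= d by rewrite normr0.
have bound (c s : R) : `|c| < d -> `|s| <= d -> `|fcoord i (g c) * s| <= d * m.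
  move=> /gmi gc sd; rewrite normrM mulrC; exact: ler_pM.
have mvt (a b : R) : a < b -> `|a| <= d -> `|b| <= d ->
    exists2 c : R, `|c| < d & fcoord i (G b) - fcoord i (G a) = fcoord i (g c) * (b - a).
  rewrite !ler_norml => ab /andP[a1 a2] /andP[b1 b2].
  have [||c] := @MVT R (fun t => fcoord i (G t)) (fun s => fcoord i (g s)) a b ab.
  - move=> s; rewrite in_itv/= => /andP[s0 st]; apply: dGi.
    by rewrite ltr_norml; lra.
  - exact: continuous_subspaceT.
  by rewrite in_itv/= => cab E; exists c => //; rewrite ltr_norml; lra.
have [t0|t0|<-] := ltgtP 0 t; last by rewrite subrr normr0 mulr_ge0.
  have [c cd ->] := mvt 0 t t0 n0d td; by rewrite subr0 bound.
have [c cd E] := mvt t 0 t0 td n0d.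
by rewrite distrC E sub0r bound// normrN.
Qed.

Variables (f : V -> V) (K : R) (z0 : V).
Hypothesis fK : forall u v, `|f u - f v| <= K * `|u - v|.
Hypothesis K0 : 0 <= K.

Let f_continuous : continuous f.
Proof.
move=> u; apply/cvgrPdist_lt => e e0; near=> v.
apply: le_lt_trans (fK _ _) _.
apply: (@le_lt_trans _ _ ((K + 1) * `|u - v|)); first by rewrite ler_wpM2r// lerDl.
rewrite -ltr_pdivlMl ?ltr_wpDl// mulrC; near: v; apply: cvgr_dist_lt => //.
by rewrite divr_gt0// ltr_wpDl.
Unshelve. all: by end_near. Qed.

(* The length for which the Picard operator halves distances. *)
Let d := (2 * B * (K + 1))^-1.

Let d0 : 0 < d.
Proof. by rewrite invr_gt0 !mulr_gt0// ltr_wpDl. Qed.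

Let d1 : d < 1.
Proof.
rewrite invf_lt1 ?mulr_gt0// ?ltr_wpDl//.
by rewrite -mulrA (@lt_le_trans _ _ 2)// ?ltr1n// ler_peMr// mulr_ege1// lerDr.
Qed.

(** One Picard iteration, as a relation. The equation is asked for on |t| < d only, but continuity
    on the whole line, so that the result can be iterated again. *)
Let picard_step (z z' : R -> V) := [/\ continuous z', z' 0 = z0 &
  forall t : R, `|t| < d -> is_derive t 1 z' (f (z t))].

Let picard_step_exists (z : R -> V) : continuous z -> exists z', picard_step z z'.
Proof.
move=> cz.
have cfz (i : 'I_(@fdim R V fV)) : continuous (fun t => fcoord i (f (z t))).
  move=> t; apply: (@continuous_comp _ _ _ (f \o z) (fcoord i)).
    by apply: continuous_comp; [exact: cz|exact: f_continuous].
  exact: fcoord_continuous.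
have /choice[G HG] : forall i : 'I_(@fdim R V fV), exists G : R -> R,
    forall t : R, -1 < t < 1 -> is_derive t 1 G (fcoord i (f (z t))).
  by move=> i; exact: continuous_antiderivative.
(* [G i] is controlled on (-1, 1) only. Since d < 1, clamping the time to [-d, d] gives a map
   continuous on the line, unchanged where the equation is required. *)
pose z' (t : R) : V := z0 + \sum_(i < @fdim R V fV) (G i (clamp d t) - G i 0) *: fvec i.
exists z'; split.
- move=> t; apply: cvgD; first exact: cvg_cst.
  apply: cvg_bigsum => i; apply: cvgZr_tmp; apply: cvgB; last exact: cvg_cst.
  apply: (@continuous_comp _ _ _ (clamp d) (G i)).
    exact: clamp_continuous.
  apply: differentiable_continuous; apply/derivable1_diffP.
  have cd : -1 < clamp d t < 1.
    by rewrite -ltr_norml (le_lt_trans _ d1)// clamp_le// ltW.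
  exact: (@ex_derive _ _ _ _ _ _ _ (HG i _ cd)).
- rewrite /z' clamp_id ?normr0 ?ltW// big1 ?addr0// => i _.
  by rewrite subrr scale0r.
move=> t td.
apply: (@near_eq_is_derive _ _ _ (fun t => z0 + \sum_(i < @fdim R V fV) (G i t - G i 0)
  *: fvec i)).
  near=> s; rewrite /z' clamp_id//.
  by apply: ltW; near: s; exact: near_norm_lt.
apply/(is_derive_fcoord (fV := fV)) => i.
under eq_fun do rewrite fcoordD fcoord_vec_sum.
have tt : -1 < t < 1 by rewrite -ltr_norml (lt_trans td).
have := HG i t tt => D.
rewrite -[fcoord i (f _)]add0r -[X in _ + X]subr0.
by apply: is_deriveD; apply: is_deriveB.
Unshelve. all: by end_near. Qed.

Let picard_contraction (z1 z2 z1' z2' : R -> V) (e : R) : 0 <= e ->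
  picard_step z1 z1' -> picard_step z2 z2' ->
  (forall t : R, `|t| <= d -> `|z1 t - z2 t| <= e) ->
  forall t : R, `|t| <= d -> `|z1' t - z2' t| <= e / 2.
Proof.
move=> e0 [c1 i1 h1] [c2 i2 h2] ze t td.
have -> : z1' t - z2' t = (fun t => z1' t - z2' t) t - (fun t => z1' t - z2' t) 0.
  by rewrite i1 i2 subrr subr0.
apply: le_trans (@mean_value_inequality (fun t => z1' t - z2' t)
  (fun t => f (z1 t) - f (z2 t)) d (K * e) _ _ _ _ _ td) _.
- by rewrite mulr_ge0.
- by move=> s; apply: cvgB; [exact: c1|exact: c2].
- by move=> s sd; apply: is_deriveB; [exact: h1|exact: h2].
- move=> s sd; apply: le_trans (fK _ _) _; rewrite ler_wpM2l// ze// ltW//.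
(* The bound d * K * e * B equals e / 2 times K / (K + 1). *)
rewrite /d invfM invfM.
rewrite (_ : _ * B = e / 2 * (K / (K + 1)) * (B / B)); last by ring.
rewrite divff ?gt_eqF// mulr1 ler_piMr ?divr_ge0//.
by rewrite ler_pdivrMr ?ltr_wpDl// mul1r lerDl.
Qed.

Lemma picard_lindelof_lipschitz : exists2 d : R, 0 < d &
  exists z : R -> V, [/\ continuous z, z 0 = z0 &
    forall t : R, `|t| < d -> is_derive t 1 z (f (z t))].
Proof.
exists d => //.
pose T (z : R -> V) := xget z (picard_step z).
have TP (z : R -> V) : continuous z -> picard_step z (T z).
  by move=> /picard_step_exists[z' H]; rewrite /T; case: xgetP => [//|/(_ z')].
pose zs k := iter k T (cst z0).
have zsc k : continuous (zs k).
  by elim: k => [|k /TP[]//]; move=> t; exact: cvg_cst.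
have zsP k : picard_step (zs k) (zs k.+1) by exact: TP.
have zs0 k : zs k 0 = z0 by case: k => // k; have [_ ->] := zsP k.
(* The first iterate differs from the constant [z0] by at most d * |f z0| * B. Halving at every step
   gives C / 2^k, and summing the tail gives 2 C / 2^k. *)
pose C := d * `|f z0| * B.
have C0 : 0 <= C by rewrite !mulr_ge0// ltW.
have step k (t : R) : `|t| <= d -> `|zs k.+1 t - zs k t| <= C / 2 ^+ k.
  elim: k t => [|k IH] t td.
    rewrite expr0 divr1.
    have [c i h] := zsP 0%N.
    have := @mean_value_inequality (zs 1%N) (fun=> f z0) d `|f z0| _ c h.
    by rewrite i; apply.
  rewrite exprSr invfM mulrA; apply: picard_contraction (zsP k.+1) (zsP k) IH t td.
  by rewrite divr_ge0// exprn_ge0.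
have geo_ge0 k : 0 <= 2 * C / 2 ^+ k.
  by apply: divr_ge0; [rewrite mulr_ge0|rewrite exprn_ge0].
have tail k m (t : R) : `|t| <= d -> `|zs (k + m)%N t - zs k t| <= 2 * C / 2 ^+ k.
  move=> td; suff : `|zs (k + m)%N t - zs k t| <= 2 * C / 2 ^+ k - 2 * C / 2 ^+ (k + m).
    move=> H; apply: le_trans H _; rewrite lerBlDr lerDl.
    exact: geo_ge0.
  elim: m => [|m IH]; first by rewrite addn0 !subrr normr0.
  rewrite addnS -(subrKA (zs (k + m)%N t)); apply: le_trans (ler_normD _ _) _.
  apply: le_trans (lerD (step _ _ td) IH) _.
  rewrite exprS invfM (_ : 2 * C * (2^-1 * _) = C / 2 ^+ (k + m)).
    by rewrite le_eqVlt; apply/orP; left; apply/eqP; ring.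
  by field; rewrite expf_neq0.
have geo0 : (fun k => 2 * C / 2 ^+ k : R) @ \oo --> 0.
  have := @cvg_geometric R (2 * C) 2^-1.
  rewrite ger0_norm ?invr_ge0// invf_lt1// ltr1n => /(_ isT).
  by apply: cvg_trans; apply: near_eq_cvg; apply: nearW => k; rewrite /geometric/= exprVn.
have lim_exists (t : R) : exists l : V, `|t| <= d -> forall k,
  `|l - zs k t| <= 2 * C / 2 ^+ k.
  have [td|td] := leP `|t| d; last by exists 0.
  (* The limit is taken coordinate by coordinate, by completeness of the real line. *)
  pose l : V := \sum_(i < @fdim R V fV) lim ((fun k => fcoord i (zs k t)) @ \oo) *: fvec i.
  have cvi (i : 'I_(@fdim R V fV)) : cvg ((fun k => fcoord i (zs k t)) @ \oo).
    apply/cauchy_cvgP/cauchy_exP => e e0.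
    have /cvgrPdist_lt/(_ e e0)[N _ HN] := geo0.
    exists (fcoord i (zs N t)); exists N => // k /= Nk.
    rewrite -ball_normE/= distrC -fcoordB; apply: le_lt_trans (fcoord_le _ _) _.
    rewrite -(subnKC Nk); apply: le_lt_trans (tail _ _ _ td) _.
    by have := HN N (leqnn N); rewrite /= sub0r normrN ger0_norm.
  have cvl : (fun k => zs k t) @ \oo --> l.
    apply: (cvg_fcoord (fV := fV)) => i; rewrite /l fcoord_vec_sum; exact: cvi.
  exists l => _ k.
  have cvn : (fun m => `|zs m t - zs k t|) @ \oo --> `|l - zs k t|.
    by apply: cvg_norm; apply: cvgB => //; exact: cvg_cst.
  apply: (cvgr_to_le cvn).
  by exists k => // m /= km; rewrite -(subnKC km); exact: tail.
have [z1 Hz1] := choice lim_exists.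
(* The limit is known on [-d, d] and is continued by its end values. *)
pose z (t : R) := z1 (clamp d t).
have Hz (t : R) k : `|t| <= d -> `|z t - zs k t| <= 2 * C / 2 ^+ k.
  by move=> td; rewrite /z (clamp_id td); exact: Hz1.
have cz : continuous z.
  move=> t; apply/cvgrPdist_lt => e e0.
  have e3 : 0 < e / 3 by rewrite divr_gt0.
  have /cvgrPdist_lt/(_ _ e3)[N _ /(_ N (leqnn N))] := geo0.
  rewrite sub0r normrN ger0_norm//.
  move=> HN.
  have ccl : {for t, continuous (fun s => zs N (clamp d s))}.
    apply: (@continuous_comp _ _ _ (clamp d) (zs N)); last exact: zsc.
    exact: clamp_continuous.
  have cl (s : R) : `|z s - zs N (clamp d s)| < e / 3.
    apply: le_lt_trans HN; rewrite /z -{1}(@clamp_id _ d (clamp d s)).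
      by apply: Hz; apply: clamp_le; exact: ltW.
    by apply: clamp_le; exact: ltW.
  near=> s.
  rewrite -(subrKA (zs N (clamp d t))); apply: le_lt_trans (ler_normD _ _) _.
  rewrite -(subrKA (zs N (clamp d s)) (zs N _)).
  rewrite (_ : e = e / 3 + (e / 3 + e / 3)); last by lra.
  apply: ltr_leD; first exact: cl.
  apply: ltW; apply: le_lt_trans (ler_normD _ _) _; apply: ltrD.
    by near: s; apply: cvgr_dist_lt.
  by rewrite distrC; exact: cl.
have z0E : z 0 = z0.
  have H0 : `|0 : R| <= d by rewrite normr0 ltW.
  have : (fun k => `|z 0 - z0|) @ \oo --> (0 : R).
    apply: squeeze_cvgr geo0; last exact: (cvg_cst 0).
    by near=> k; rewrite normr_ge0/= -(zs0 k); exact: Hz.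
  move=> /cvg_lim -/(_ (@norm_hausdorff _ _)); rewrite lim_cst//.
  by move=> /eqP; rewrite normr_eq0 subr_eq0 => /eqP.
exists z; split => // t td.
(* [Z] is one more iteration, applied to the limit [z]. The iterates converge both to [z] and, by
   contraction, to [Z]; so the two agree on [-d, d] and [z] inherits the derivative of [Z]. *)
have [Z ZP] := picard_step_exists cz.
have zZ (s : R) : `|s| <= d -> z s = Z s.
  move=> sd.
  have : (fun k => `|z s - Z s|) @ \oo --> (0 : R).
    have geo2 : (fun k => 2 * (2 * C / 2 ^+ k) : R) @ \oo --> 0.
      by rewrite -(mulr0 2); apply: cvgMl_tmp.
    apply: squeeze_cvgr geo2; last exact: (cvg_cst 0).
    near=> k; rewrite normr_ge0/=.
    rewrite -(subrKA (zs k.+1 s)); apply: le_trans (ler_normD _ _) _.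
    have P0 := geo_ge0 k.
    have := picard_contraction P0 (zsP k) ZP _ sd.
    move=> /(_ _) H1; have {}H1 : `|zs k.+1 s - Z s| <= 2 * C / 2 ^+ k / 2.
      by apply: H1 => u ud; rewrite distrC; exact: Hz.
    have H2 := Hz s k.+1 sd.
    have H3 : 2 * C / 2 ^+ k.+1 = 2 * C / 2 ^+ k / 2 by rewrite exprSr invfM mulrA.
    by rewrite H3 in H2; lra.
  move=> /cvg_lim -/(_ (@norm_hausdorff _ _)); rewrite lim_cst//.
  by move=> /eqP; rewrite normr_eq0 subr_eq0 => /eqP.
have [_ _ /(_ t td)] := ZP.
apply: near_eq_is_derive; near=> s; rewrite zZ//.
by apply: ltW; near: s; exact: near_norm_lt.
Unshelve. all: by end_near. Qed.

End picard.

Section smooth_ode_existence.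
Context {R : realType} {V : normedModType R} {fV : finite_dim V}.

Local Notation dim := (@fdim R V fV).

Let box_clamp (z0 : V) (r : R) (v : V) : V :=
  z0 + \sum_(i < dim) clamp r (fcoord i (v - z0)) *: fvec i.

(* Precomposing with the projection onto a small box around [z0] makes the field
   globally Lipschitz without changing it near [z0]. *)
Lemma smooth_ode_exists (U : set V) (f : V -> V) (z0 : V) :
  open U -> smooth_on U f -> U z0 ->
  exists2 d : R, 0 < d & exists z : R -> V, z 0 = z0 /\
    forall t : R, `|t| < d -> U (z t) /\ is_derive t 1 z (f (z t)).
Proof.
move=> oU sf Uz0.
pose D (i j : 'I_dim) := 'D_(fvec j) (fun x => fcoord i (f x)).
have sfi (i : 'I_dim) : smooth_on U (fun x => fcoord i (f x)).
  by move: i; apply/smooth_fcoord.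
have DM : \forall x \near z0, forall i j, `|D i j x| <= `|D i j z0| + 1.
  apply: filter_forall => i; apply: filter_forall => j.
  have /cvgrPdist_lt/(_ 1 ltr01) := smooth_continuous (smooth_derive (fvec j) (sfi i)) Uz0.
  apply: filterS => x; rewrite -/(D i j) => H.
  rewrite -[D i j x](subKr (D i j z0)); apply: le_trans (ler_normB _ _) _.
  by rewrite lerD2l ltW.
have /(@nbhs_ballP R V)[e /= e0 He] : \forall x \near z0, U x /\
    forall i j, `|D i j x| <= `|D i j z0| + 1.
  by apply: filterS2 DM (open_near oU Uz0) => x.
pose N : R := 1 + \sum_(i < dim) `|fvec i : V|.
have N0 : 0 < N by rewrite ltr_wpDr// sumr_ge0.
(* A coordinate box of half-side [r] has radius at most r * N, hence fits in the ball of radius [e]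
   where the partial derivatives are bounded. *)
have [r r0 rN] : exists2 r : R, 0 < r & r * N < e.
  exists (e / 2 / N); first by rewrite !divr_gt0.
  by rewrite divfK ?gt_eqF//; lra.
have box v : (forall i : 'I_dim, `|fcoord i (v - z0)| <= r) -> ball z0 e v.
  move=> H; rewrite -ball_normE/= distrC; apply: le_lt_trans rN.
  apply: le_trans (norm_le_fcoord H) _.
  by apply: ler_wpM2l; [exact: ltW|rewrite /N lerDr].
have cE v (i : 'I_dim) : fcoord i (box_clamp z0 r v - z0) = clamp r (fcoord i (v - z0)).
  by rewrite /box_clamp addrAC subrr add0r fcoord_vec_sum.
(* A crude Lipschitz constant: every row of the Jacobian is bounded by the sum of all the entrywise
   bounds. *)
pose M := \sum_i \sum_j (`|D i j z0| + 1).
have M0 : 0 <= M by apply: sumr_ge0 => i _; apply: sumr_ge0 => j _; rewrite addr_ge0.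
have fL u v : `|f (box_clamp z0 r u) - f (box_clamp z0 r v)| <= M * N * `|u - v|.
  rewrite mulrAC.
  have N' : \sum_(i < dim) `|fvec i : V| <= N by rewrite /N lerDr.
  apply: le_trans (ler_wpM2l _ N'); last by rewrite mulr_ge0.
  apply: (norm_le_fcoord (fV := fV)) => i; rewrite fcoordB.
  pose a := box_clamp z0 r v; pose w := box_clamp z0 r u - a.
  have -> : box_clamp z0 r u = a + w by rewrite /w addrC subrK.
  (* The box is convex, so the segment between two projected points stays where the derivatives are
     bounded. *)
  have seg (s : R) : 0 <= s <= 1 -> ball z0 e (a + s *: w).
    move=> /andP[s0 s1]; apply: box => j.
    have -> : fcoord j (a + s *: w - z0) =
        (1 - s) * fcoord j (a - z0) + s * fcoord j (box_clamp z0 r u - z0).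
      by rewrite /w !(fcoordB, fcoordD, fcoordZ); ring.
    rewrite !cE; apply: le_trans (ler_normD _ _) _.
    rewrite !normrM (ger0_norm s0) (@ger0_norm _ (1 - s)) ?subr_ge0//.
    rewrite [leRHS](_ : _ = (1 - s) * r + s * r); last by ring.
    by apply: lerD; apply: ler_wpM2l; rewrite ?subr_ge0// clamp_le// ltW.
  have [s s01 ->] : exists2 s : R, 0 < s < 1 & fcoord i (f (a + w)) - fcoord i (f a) =
      'D_w (fun x => fcoord i (f x)) (a + s *: w).
    apply: (@mvt_line _ _ (fun x => fcoord i (f x))) => s s01.
    by apply: smooth_derivable (sfi i) _; have [] := He _ (seg s s01).
  have s01' : 0 <= s <= 1 by case/andP: s01 => ? ?; rewrite !ltW.
  have [Us Ds] := He _ (seg s s01').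
  rewrite (derive_fvec fV); last exact: smooth_differentiable (sfi i) Us.
  apply: le_trans (ler_norm_sum _ _ _) _.
  rewrite /M [leRHS]mulr_suml [leRHS](bigD1 i)//= -[leLHS]addr0; apply: lerD; last first.
    by apply: sumr_ge0 => j _; rewrite mulr_ge0// sumr_ge0// => k _; rewrite addr_ge0.
  rewrite mulr_suml; apply: ler_sum => j _; rewrite normrM mulrC.
  apply: ler_pM; [by []|by []|exact: Ds|].
  have -> : fcoord j w = clamp r (fcoord j (u - z0)) - clamp r (fcoord j (v - z0)).
    by rewrite -!cE -fcoordB /w /a opprB addrA subrK.
  apply: le_trans (clamp_lipschitz _ _ _) _.
  rewrite -fcoordB opprB addrA subrK; exact: fcoord_le.
have MN0 : 0 <= M * N by rewrite mulr_ge0// ltW.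
have [d d0 [z [cz z0E dz]]] := picard_lindelof_lipschitz z0 fL MN0.
(* For a short time the solution stays in the box, where the truncated field is the original one. *)
have near_r : \forall t \near (0 : R), forall i : 'I_dim, `|fcoord i (z t - z0)| <= r.
  have H0 : \forall t \near (0 : R), `|z0 - z t| < r.
    by have /cvgrPdist_lt/(_ _ r0) := cz 0; rewrite z0E.
  apply: filterS H0 => t H i; apply: le_trans (fcoord_le _ _) _.
  by rewrite distrC ltW.
have /(@nbhs_ballP R R)[d' /= d'0 Hd'] := near_r.
exists (Num.min d d'); first by rewrite lt_min d0.
exists z; split => // t; rewrite lt_min => /andP[td td'].
have H : forall i : 'I_dim, `|fcoord i (z t - z0)| <= r.
  by apply: Hd'; rewrite -ball_normE/= sub0r normrN.
split; first by have [] := He _ (box _ H).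
have -> : f (z t) = f (box_clamp z0 r (z t)); last exact: dz.
congr f; rewrite /box_clamp.
under eq_bigr do rewrite clamp_id//.
by rewrite -fcoordE addrC subrK.
Qed.

End smooth_ode_existence.

Section auxiliary.
Variable R : realType.

Lemma is_derive_pair (V W : normedModType R) (f : R -> V) (g : R -> W) (t : R)
    (a : V) (b : W) :
  is_derive t 1 f a -> is_derive t 1 g b ->
  is_derive t 1 (fun s => (f s, g s)) (a, b).
Proof.
move=> [df fE] [dg gE].
have df' : differentiable f t by apply/derivable1_diffP.
have dg' : differentiable g t by apply/derivable1_diffP.
have dp := differentiable_pair df' dg'.
split; first exact: diff_derivable.
by rewrite deriveE// diff_pair//= -!deriveE// fE gE.
Qed.

Lemma is_derive_linear (V W : normedModType R) (f : {linear V -> W}) (x v : V) :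
  continuous f -> is_derive x v f (f v).
Proof.
move=> cf; have df : differentiable f x by exact: linear_differentiable.
split; first exact: diff_derivable.
by rewrite deriveE// diff_lin.
Qed.

Lemma is_derive_scaler (V : normedModType R) (a : R) (x v : V) :
  is_derive x v (fun z : V => a *: z) (a *: v).
Proof. by have := @is_deriveZ _ _ _ (@id V) a x v v (is_derive_id x v). Qed.

Lemma is_derive_comp_scalar (W : normedModType R) (f : R -> W) (g : R -> R)
    (t dg : R) (df : W) :
  is_derive t 1 g dg -> is_derive (g t) 1 f df ->
  is_derive t 1 (fun s => f (g s)) (dg *: df).
Proof.
move=> hg [hf fE].
have hf' : differentiable f (g t) by apply/derivable1_diffP.
have := is_derive_comp hg hf'.
by rewrite -[X in 'D_X _ _]mulr1 -[dg * 1]/(dg *: 1) deriveZ_dir// fE.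
Qed.

Lemma is_deriveM_fun (V : normedModType R) (f g : V -> R) (x v : V) (a b : R) :
  is_derive x v f a -> is_derive x v g b ->
  is_derive x v (fun y => f y * g y) (a * g x + f x * b).
Proof.
move=> [df fE] [dg gE]; apply: DeriveDef; first exact: (derivableM df dg).
rewrite (deriveM df dg) fE gE addrC.
by rewrite -[g x *: a]/(g x * a) [g x * a]mulrC.
Qed.

Lemma is_derive_sum_fun (V W : normedModType R) (I : Type) (r : seq I)
    (f : I -> V -> W) (x v : V) (a : I -> W) :
  (forall i, is_derive x v (f i) (a i)) ->
  is_derive x v (fun y => \sum_(i <- r) f i y) (\sum_(i <- r) a i).
Proof.
move=> H; elim: r => [|i r IH].
  rewrite big_nil; under eq_fun do rewrite big_nil; exact: is_derive_cst.
by rewrite big_cons; under eq_fun do rewrite big_cons; exact: is_deriveD.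
Qed.

Lemma is_derive_unique (V W : normedModType R) (f : V -> W) (x v : V) (a b : W) :
  is_derive x v f a -> is_derive x v f b -> a = b.
Proof. by move=> [_ <-] [_ <-]. Qed.

Lemma smooth_differentiable_vec (V W : normedModType R) {fV : finite_dim V}
    {fW : finite_dim W} (U : set V) (f : V -> W) x :
  open U -> smooth_on U f -> U x -> differentiable f x.
Proof.
move=> oU sf Ux.
have -> : f = \sum_(i < @fdim R W fW) (fun y => fcoord i (f y) *: fvec i).
  by apply/funext => y; rewrite fct_sumE; exact: fcoordE.
apply: differentiable_sum => i; apply: differentiableZl.
apply: (smooth_differentiable oU _ Ux); exact: ((smooth_fcoord f oU).2 sf i).
Qed.

Lemma smooth_id (V : normedModType R) {fV : finite_dim V} (U : set V) :
  open U -> smooth_on U (id : V -> V).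
Proof. by move=> oU; apply/(smooth_fcoord (fW := fV)) => // i; exact: smooth_coord. Qed.

End auxiliary.

(** * Euler-Lagrange equations *)

Section lagrangian.
Context {R : realType} {n : nat}.
Local Notation V := 'rV[R]_n.
Implicit Types (L : V -> V -> R) (U : set V) (c : R -> V).

Definition joint L (p : V * V) : R := L p.1 p.2.

(** The tangent bundle over [U] without its zero section, the set on which a Finsler metric is
    smooth. *)
Definition slit U : set (V * V) := [set p | U p.1 /\ p.2 != 0].

Lemma open_slit U : open U -> open (slit U).
Proof.
move=> oU; have -> : slit U = (fst @^-1` U) `&` ((fun p : V * V => `|p.2|) @^-1`
  [set r | 0 < r]).
  by apply/seteqP; split => p /=; rewrite /slit/= normr_gt0.
apply: openI; first by apply: open_comp => // p _; exact: cvg_fst.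
apply: open_comp; last exact: open_gt.
move=> p _; apply: (@continuous_comp _ _ _ snd (fun y : V => `|y|)).
  exact: cvg_snd.
exact: norm_continuous.
Qed.

Lemma derive_joint_snd L x y v : 'D_v (L x) y = 'D_(0, v) (joint L) (x, y).
Proof.
rewrite /derive; set d := (fun _ : R => _); set d' := (fun _ : R => _).
suff -> : d = d' by [].
by apply/funext => h; rewrite /d /d' /joint/= scaler0 add0r.
Qed.

Lemma derive_joint_fst L x y v : 'D_v (fun z => L z y) x = 'D_(v, 0) (joint L) (x, y).
Proof.
rewrite /derive; set d := (fun _ : R => _); set d' := (fun _ : R => _).
suff -> : d = d' by [].
by apply/funext => h; rewrite /d /d' /joint/= scaler0 add0r.
Qed.

Lemma differentiable_joint_snd L x y :
  differentiable (joint L) (x, y) -> differentiable (L x) y.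
Proof.
move=> dL.
have dp : differentiable (fun z : V => (x, z)) y.
  by apply: differentiable_pair => //; exact: differentiable_cst.
exact: (@differentiable_comp _ _ _ _ (fun z : V => (x, z)) (joint L)).
Qed.

Lemma differentiable_joint_fst L x y :
  differentiable (joint L) (x, y) -> differentiable (fun z => L z y) x.
Proof.
move=> dL.
have dp : differentiable (fun z : V => (z, y)) x.
  by apply: differentiable_pair => //; exact: differentiable_cst.
exact: (@differentiable_comp _ _ _ _ (fun z : V => (z, y)) (joint L)).
Qed.

Lemma derive_pair_dir (f : V * V -> R) p (u v : V) : differentiable f p ->
  'D_(u, v) f p = 'D_(u, 0) f p + 'D_(0, v) f p.
Proof.
move=> df; rewrite -(deriveD_dir (u, 0) (0, v) df); congr ('D_ _ _ _).
by congr pair; rewrite /= ?addr0 ?add0r.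
Qed.

Lemma derive_delta (f : V -> R) x v : differentiable f x ->
  'D_v f x = \sum_k v 0 k * 'D_(delta_mx 0 k) f x.
Proof. exact: derive_fvec. Qed.

Lemma derive_delta_snd (f : V * V -> R) p (v : V) : differentiable f p ->
  'D_(0, v) f p = \sum_k v 0 k * 'D_(0, delta_mx 0 k) f p.
Proof.
move=> df; rewrite -(derive_sum_dir _ (fun k => v 0 k) (fun k => (0, delta_mx 0 k)) df).
rewrite {1}(row_sum_delta v); congr ('D_ _ _ _).
elim/big_rec2: _ => // i y x _ <-.
by congr pair; rewrite /= scaler0 addr0.
Qed.

Lemma derive_delta_fst (f : V * V -> R) p (v : V) : differentiable f p ->
  'D_(v, 0) f p = \sum_k v 0 k * 'D_(delta_mx 0 k, 0) f p.
Proof.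
move=> df; rewrite -(derive_sum_dir _ (fun k => v 0 k) (fun k => (delta_mx 0 k, 0)) df).
rewrite {1}(row_sum_delta v); congr ('D_ _ _ _).
elim/big_rec2: _ => // i y x _ <-.
by congr pair; rewrite /= scaler0 addr0.
Qed.

Definition euler_lagrange L c (t : R) := forall k,
  is_derive t 1 (fun s => 'D_(delta_mx 0 k) (L (c s)) (derive1 c s))
    ('D_(delta_mx 0 k) (fun x => L x (derive1 c t)) (c t)).

(** What it takes to differentiate a function of (c, c') at [t]: two derivatives of [c], and a
    velocity off the zero section. *)
Definition regular_at U c (t : R) :=
  [/\ \forall s \near t, derivable c s 1, derivable (derive1 c) t 1 &
      slit U (c t, derive1 c t)].

Definition half_square L : V -> V -> R := fun x y => 2^-1 * L x y ^+ 2.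

Section homogeneous.
Variables (U : set V) (L : V -> V -> R).
Hypotheses (oU : open U) (sL : smooth_on (slit U) (joint L)).
Hypothesis (L_homo : forall x y (l : R), U x -> 0 < l -> L x (l *: y) = l * L x y).
Hypothesis (L_pos : forall x y, U x -> y != 0 -> 0 < L x y).

Let dL p : slit U p -> differentiable (joint L) p.
Proof. by apply: smooth_differentiable => //; exact: open_slit. Qed.

(** Derivatives in y are homogeneous of degree 0, whereas those in x keep degree 1 in y. This is why
    an increasing change of parameter multiplies both sides of the Euler-Lagrange equations of [L]
    by the same factor. *)
Lemma derive_homogeneous x y v (l : R) : U x -> y != 0 -> 0 < l ->
  'D_v (L x) (l *: y) = 'D_v (L x) y.
Proof.
move=> Ux y0 l0.
have d : differentiable (L x) y by apply: differentiable_joint_snd; exact: dL.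
have E : L x = fun z => l * L x (l^-1 *: z).
  by apply/funext => z; rewrite -L_homo// scalerA divff ?scale1r// gt_eqF.
have lK : l^-1 *: (l *: y) = y by rewrite scalerA mulVf ?scale1r// gt_eqF.
have D : is_derive (l *: y) v (fun z => l * L x (l^-1 *: z)) (l *: 'D_(l^-1 *: v) (L x) y).
  apply: is_deriveZ; rewrite -{2}lK.
  apply: (@is_derive_comp _ _ _ _ (fun z => l^-1 *: z) (L x)); last by rewrite lK.
rewrite [in LHS]E (@derive_val _ _ _ _ _ _ _ D) deriveZ_dir//.
by rewrite scalerA divff ?scale1r// gt_eqF.
Qed.

Lemma derive_homogeneous_fst x y v (l : R) : U x -> y != 0 -> 0 < l ->
  'D_v (fun z => L z (l *: y)) x = l * 'D_v (fun z => L z y) x.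
Proof.
move=> Ux y0 l0.
have d : differentiable (fun z => L z y) x by apply: differentiable_joint_fst; exact: dL.
have D : is_derive x v (fun z => l * L z y) (l *: 'D_v (fun z => L z y) x).
  by apply: is_deriveZ; apply: derivableP; exact: diff_derivable.
rewrite -[RHS](@derive_val _ _ _ _ _ _ _ D); apply: near_eq_derive.
by apply: filterS (open_near oU Ux) => z Uz; rewrite L_homo.
Qed.

(** Differentiate L(x, (1 + h) y) = (1 + h) L(x, y) at h = 0; homogeneity applies because 1 + h > 0
    near 0. *)
Lemma euler_homogeneous x y : U x -> y != 0 -> 'D_y (L x) y = L x y.
Proof.
move=> Ux y0.
have d : differentiable (L x) y by apply: differentiable_joint_snd; exact: dL.
have /is_derive1P D1 := derivableP (@diff_derivable _ _ _ _ _ y d).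
have D2 : is_derive (0 : R) 1 (fun h : R => L x (h *: y + y)) (L x y).
  apply: (@near_eq_is_derive _ _ _ (fun h : R => h * L x y + L x y)).
    near=> h; have -> : h *: y + y = (h + 1) *: y by rewrite scalerDl scale1r.
    rewrite L_homo//; first by rewrite mulrDl mul1r.
    rewrite -ltrBlDr sub0r ltrNl; apply: le_lt_trans (ler_norm _) _.
    rewrite normrN; near: h. by apply: near_norm_lt; rewrite normr0.
  rewrite -[X in is_derive _ _ _ X]addr0; apply: is_deriveD.
  rewrite -[X in is_derive _ _ _ X]mul1r.
  have := @is_deriveM_fun R R id (cst (L x y)) 0 1 1 0 _ _.
  by rewrite mulr0 addr0; apply.
exact: is_derive_unique D1 D2.
Unshelve. all: by end_near. Qed.

Let cancel_factor (l p q : R) : l != 0 -> l * q * l^-1 + p * 0 = q.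
Proof. by move=> l0; rewrite mulr0 addr0 mulrAC divff// mul1r. Qed.

Let cancel_factor0 (l q : R) : l != 0 -> l * q * l^-1 = q.
Proof. by move=> l0; rewrite mulrAC divff// mul1r. Qed.

Let mul0_add (p q : R) : 0 * p + q = q.
Proof. by rewrite mul0r add0r. Qed.

Let half_sum (a b : R) : (b * a + a * b) * 2^-1 = a * b.
Proof. by field. Qed.

Lemma derive_half_square_snd x y v : U x -> y != 0 ->
  'D_v (half_square L x) y = L x y * 'D_v (L x) y.
Proof.
move=> Ux y0.
have d : differentiable (L x) y by apply: differentiable_joint_snd; exact: dL.
have D := derivableP (@diff_derivable _ _ _ _ _ v d).
have D2 : is_derive y v (half_square L x)
  (2^-1 *: ('D_v (L x) y * L x y + L x y * 'D_v (L x) y)).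
  by apply: is_deriveZ; exact: is_deriveM_fun.
rewrite (@derive_val _ _ _ _ _ _ _ D2).
exact: etrans (mulrC _ _) (half_sum _ _).
Qed.

Lemma derive_half_square_fst x y v : U x -> y != 0 ->
  'D_v (fun z => half_square L z y) x = L x y * 'D_v (fun z => L z y) x.
Proof.
move=> Ux y0.
have d : differentiable (fun z => L z y) x by apply: differentiable_joint_fst; exact: dL.
have D := derivableP (@diff_derivable _ _ _ _ _ v d).
have D2 : is_derive x v (fun z => half_square L z y)
    (2^-1 *: ('D_v (fun z => L z y) x * L x y + L x y * 'D_v (fun z => L z y) x)).
  by apply: is_deriveZ; exact: is_deriveM_fun.
rewrite (@derive_val _ _ _ _ _ _ _ D2).
exact: etrans (mulrC _ _) (half_sum _ _).
Qed.

Section curve.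
Variables (c : R -> V) (t : R).
Hypothesis rc : regular_at U c t.

Lemma regular_is_derive :
  is_derive t 1 (fun s => (c s, derive1 c s)) (derive1 c t, derive1 (derive1 c) t).
Proof.
have [dc d2c _] := rc.
have D1 : is_derive t 1 c (derive1 c t).
  by rewrite derive1E; apply: derivableP; exact: (nbhs_singleton dc).
have D2 : is_derive t 1 (derive1 c) (derive1 (derive1 c) t).
  by rewrite derive1E; exact: derivableP.
exact: is_derive_pair D1 D2.
Qed.

Lemma near_slit : \forall s \near t, slit U (c s, derive1 c s).
Proof.
have [_ _ W] := rc.
have cw : {for t, continuous (fun s => (c s, derive1 c s))}.
  apply: differentiable_continuous; apply/derivable1_diffP.
  exact: (@ex_derive _ _ _ _ _ _ _ regular_is_derive).
by apply: cw; exact: open_near (open_slit oU) W.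
Qed.

Lemma is_derive_along (f : V * V -> R) : differentiable f (c t, derive1 c t) ->
  is_derive t 1 (fun s => f (c s, derive1 c s))
    ('D_(derive1 c t, 0) f (c t, derive1 c t) +
     'D_(0, derive1 (derive1 c) t) f (c t, derive1 c t)).
Proof.
move=> df; rewrite -(derive_pair_dir _ _ df).
apply: (@is_derive_comp _ _ _ _ (fun s => (c s, derive1 c s)) f) => //.
exact: regular_is_derive.
Qed.

(* Differentiating Euler's identity [y . E_y = 2 E] for [E = L^2 / 2] along the
   curve gives twice the derivative of [E], and the Euler-Lagrange equations
   also give it once. *)
Lemma euler_lagrange_half_square_speed : euler_lagrange (half_square L) c t ->
  is_derive t 1 (fun s => L (c s) (derive1 c s)) 0.
Proof.
move=> EL.
have [dc d2c [/= Ux y0]] := rc.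
set x := c t in Ux *; set y := derive1 c t in y0 *; set a := derive1 (derive1 c) t.
have D := is_derive_along (dL (p := (x, y)) (conj Ux y0)).
set m := _ + _ in D.
suff m0 : m = 0 by rewrite -m0.
have L0 := L_pos Ux y0.
have D1 : is_derive t 1 (fun s => L (c s) (derive1 c s) * L (c s) (derive1 c s))
    (m * L x y + L x y * m).
  exact: is_deriveM_fun.
have dck k : is_derive t 1 (fun s => derive1 c s 0 k) (a 0 k).
  have /(is_derive_fcoord (fV := finite_dim_rV R n)) : is_derive t 1 (derive1 c) a.
    by rewrite /a derive1E; exact: derivableP.
  exact.
have D2 : is_derive t 1 (fun s => \sum_k derive1 c s 0 k *
      'D_(delta_mx 0 k) (half_square L (c s)) (derive1 c s))
    (\sum_k (a 0 k * 'D_(delta_mx 0 k) (half_square L x) y +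
      y 0 k * 'D_(delta_mx 0 k) (fun z => half_square L z y) x)).
  by apply: is_derive_sum_fun => k; exact: is_deriveM_fun.
have E : \near t, L (c t) (derive1 c t) * L (c t) (derive1 c t) =
    \sum_k derive1 c t 0 k * 'D_(delta_mx 0 k) (half_square L (c t)) (derive1 c t).
  apply: filterS near_slit => s [/= Us ys].
  under eq_bigr do rewrite derive_half_square_snd// mulrCA.
  rewrite -mulr_sumr -derive_delta ?euler_homogeneous//.
  by apply: differentiable_joint_snd; exact: dL.
have := is_derive_unique (near_eq_is_derive E D1) D2.
under eq_bigr do rewrite derive_half_square_snd// derive_half_square_fst//
  mulrCA [X in _ + X]mulrCA -mulrDr.
rewrite -mulr_sumr big_split/= -!derive_delta//; last first.
- by apply: differentiable_joint_snd; exact: dL.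
- by apply: differentiable_joint_fst; exact: dL.
have -> : 'D_a (L x) y + 'D_y (fun z => L z y) x = m.
  by rewrite derive_joint_snd derive_joint_fst addrC.
move=> /eqP; rewrite -[X in _ == X]add0r (inj_eq (addIr _)) mulf_eq0.
by rewrite (gt_eqF L0) orbF => /eqP.
Qed.

(** Both partial derivatives of L^2 / 2 are [L] times those of [L]. When [L] is constant along the
    curve this factor passes through d/dt, and it cancels because it is positive. *)
Lemma euler_lagrange_half_square : euler_lagrange (half_square L) c t <->
  is_derive t 1 (fun s => L (c s) (derive1 c s)) 0 /\ euler_lagrange L c t.
Proof.
have [dc d2c [/= Ux y0]] := rc.
have L0 := L_pos Ux y0.
split=> [EL|[D EL] k].
  have D := euler_lagrange_half_square_speed EL; split => // k.
  have := EL k; rewrite derive_half_square_fst// => Dk.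
  have DV : is_derive t 1 (fun s => (L (c s) (derive1 c s))^-1) 0.
    have := @is_derive_comp _ _ _ _ (fun s => L (c s) (derive1 c s)) (fun r : R => r^-1)
      _ _ _ D.
    by rewrite derive0; apply; apply: differentiable_Rinv; rewrite gt_eqF.
  have Q := is_deriveM_fun Dk DV; rewrite (cancel_factor _ _ (lt0r_neq0 L0)) in Q.
  apply: near_eq_is_derive Q; apply: filterS near_slit => s [/= Us ys].
  rewrite derive_half_square_snd//; exact: (cancel_factor0 _ (lt0r_neq0 (L_pos Us ys))).
rewrite derive_half_square_fst//.
have Q := is_deriveM_fun D (EL k); rewrite mul0_add in Q.
apply: near_eq_is_derive Q; apply: filterS near_slit => s [/= Us ys].
by rewrite derive_half_square_snd.
Qed.

End curve.

End homogeneous.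
End lagrangian.

Lemma derive1_comp_scalar (R : realType) (W : normedModType R) (f : R -> W)
    (g : R -> R) (s : R) : derivable g s 1 -> derivable f (g s) 1 ->
  derive1 (fun s => f (g s)) s = derive1 g s *: derive1 f (g s).
Proof.
move=> /derivableP dg /derivableP df; rewrite !derive1E.
by have /@derive_val := is_derive_comp_scalar dg df.
Qed.

Lemma near_comp (T T' : topologicalType) (g : T -> T') (P : T' -> Prop) (t : T) :
  {for t, continuous g} -> (\forall y \near g t, P y) -> \forall s \near t, P (g s).
Proof. by move=> cg H; exact: cg. Qed.

(** * Reversing a curve by a decreasing change of parameter *)

Section reversal.
Context {R : realType} {n : nat}.
Local Notation V := 'rV[R]_n.
Variables (U : set V) (L : V -> V -> R) (b : V -> V).
Hypotheses (oU : open U) (sL : smooth_on (slit U) (joint L)) (sb : smooth_on U b).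
Hypothesis (L_homo : forall x y (l : R), U x -> 0 < l -> L x (l *: y) = l * L x y).
Hypothesis (L_opp : forall x y, U x -> L x (- y) = L x y - 2 * lin_form (b x) y).

Let dL p : slit U p -> differentiable (joint L) p.
Proof. by apply: smooth_differentiable => //; exact: open_slit. Qed.

Lemma lin_form_smooth (v : V) : smooth_on U (fun x => lin_form (b x) v).
Proof.
apply: (smooth_sum oU) => k; apply: (smoothM oU); last exact: smooth_cst.
exact: ((smooth_fcoord b oU).2 sb k).
Qed.

Lemma derive_lin_form (w y v : V) : is_derive y v (lin_form w) (lin_form w v).
Proof.
apply: is_derive_sum_fun => k.
have D : is_derive y v (fun z : V => z 0 k) (v 0 k) by exact:
  (is_derive_coord (fV := finite_dim_rV R n) k y v).
have := is_deriveM_fun (is_derive_cst (w 0 k) y v) D.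
by rewrite /cst mul0r add0r.
Qed.

(** L(x, -z) = L(x, z) - 2 b(z) is differentiated at z = y in direction -v; on the left the two
    signs cancel and leave the derivative along v at -y. *)
Lemma derive_opp_snd (x y v : V) : U x -> y != 0 ->
  'D_v (L x) (- y) = - 'D_v (L x) y + 2 * lin_form (b x) v.
Proof.
move=> Ux y0.
have ny0 : - y != 0 by rewrite oppr_eq0.
have d : differentiable (L x) y by apply: differentiable_joint_snd; exact: dL.
have nd : differentiable (L x) (- y) by apply: differentiable_joint_snd; exact: dL.
have D1 : is_derive y (- v) (fun z => L x (- z)) ('D_v (L x) (- y)).
  rewrite -[X in 'D_X _ _]opprK; apply: (is_derive_comp (g := fun z : V => - z)); exact: nd.
have D2 : is_derive y (- v) (fun z => L x z - 2 *: lin_form (b x) z)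
    ('D_(- v) (L x) y - 2 *: lin_form (b x) (- v)).
  apply: is_deriveB; first by apply: derivableP; exact: diff_derivable.
  by apply: is_deriveZ; exact: derive_lin_form.
have E : (fun z => L x (- z)) = (fun z => L x z - 2 *: lin_form (b x) z).
  by apply/funext => z; rewrite L_opp.
rewrite E in D1; rewrite (is_derive_unique D1 D2).
have -> : 'D_(- v) (L x) y = - 'D_v (L x) y by rewrite -scaleN1r (deriveZ_dir _ _ d)
  scaleN1r.
have -> : lin_form (b x) (- v) = - lin_form (b x) v.
  by rewrite /lin_form -sumrN; apply: eq_bigr => k _; rewrite mxE mulrN.
by rewrite -[2 *: _]/(2 * _) mulrN opprK.
Qed.

Lemma derive_opp_fst (x y v : V) : U x -> y != 0 ->
  'D_v (fun z => L z (- y)) x =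
  'D_v (fun z => L z y) x - 2 * 'D_v (fun z => lin_form (b z) y) x.
Proof.
move=> Ux y0.
have d : differentiable (fun z => L z y) x by apply: differentiable_joint_fst; exact: dL.
have db := smooth_derivable (v := v) (lin_form_smooth y) Ux.
have D : is_derive x v (fun z => L z y - 2 *: lin_form (b z) y)
    ('D_v (fun z => L z y) x - 2 *: 'D_v (fun z => lin_form (b z) y) x).
  apply: is_deriveB; first by apply: derivableP; exact: diff_derivable.
  by apply: is_deriveZ; exact: derivableP.
rewrite -[RHS](@derive_val _ _ _ _ _ _ _ D); apply: near_eq_derive.
by apply: filterS (open_near oU Ux) => z Uz; rewrite L_opp.
Qed.

Variables (c : R -> V) (theta : R -> R) (t : R).
Hypothesis (rc : regular_at U c (theta t)).
Hypothesis (dtheta : \forall s \near t, derivable theta s 1).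
Hypothesis (d2theta : derivable (derive1 theta) t 1).
Hypothesis (theta_decr : derive1 theta t < 0).

Let theta_continuous : {for t, continuous theta}.
Proof.
apply: differentiable_continuous; apply/derivable1_diffP.
exact: (nbhs_singleton dtheta).
Qed.

Lemma derive1_reversal : \forall s \near t,
  derive1 (fun s => c (theta s)) s = derive1 theta s *: derive1 c (theta s) /\
  derive1 theta s < 0 /\ slit U (c (theta s), derive1 c (theta s)).
Proof.
have [dc _ _] := rc.
have dc' := near_comp theta_continuous dc.
have W' := near_comp theta_continuous (near_slit oU rc).
have cth : {for t, continuous (derive1 theta)}.
  by apply: differentiable_continuous; exact/derivable1_diffP.
have th0 : \forall s \near t, derive1 theta s < 0.
  by apply: (cvgr_lt _ cth).
apply: filterS (filterI (filterI dtheta dc') (filterI th0 W')) => s [[ds dcs] [sn Ws]].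
exact: conj (derive1_comp_scalar ds dcs) (conj sn Ws).
Qed.

Lemma regular_at_reversal : regular_at U (fun s => c (theta s)) t.
Proof.
have [dc d2c [Ux y0]] := rc; split.
- have dc' := near_comp theta_continuous dc.
  apply: filterS (filterI dtheta dc') => s [ds dcs].
  exact: (@ex_derive _ _ _ _ _ _ _ (is_derive_comp_scalar (derivableP ds)
    (derivableP dcs))).
- apply: (@near_eq_derivable _ _ _ (fun s => derive1 theta s *: derive1 c (theta s))).
    by apply: filterS derive1_reversal => s [->].
  have H := is_derive_comp_scalar (derivableP (nbhs_singleton dtheta)) (derivableP d2c).
  apply/(derivable_fcoord (fV := finite_dim_rV R n)) => k.
  under eq_fun do rewrite fcoordZ.
  apply: (derivableM d2theta).
  exact: ((derivable_fcoord (fV := finite_dim_rV R n) _ _ _).1 (@ex_derive _ _ _ _ _ _ _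
    H) k).
- have [-> [tn _]] := nbhs_singleton derive1_reversal.
  by split; rewrite //= scaler_eq0 (lt_eqF tn).
Qed.

(** The reversed velocity is (-theta')(-c') with -theta' > 0. By homogeneity and [L_opp], its
    momentum is -L_y + 2 b, with derivative -theta' L_x + 2 theta' D_{c'} b. The x-derivative at the
    reversed velocity is -theta' (L_x - 2 D_k b(c')). The difference is 2 theta' db(c', e_k). *)
Lemma euler_lagrange_reversal :
  euler_lagrange L c (theta t) -> forall k,
  is_derive t 1 (fun s => 'D_(delta_mx 0 k) (L (c (theta s)))
    (derive1 (fun s => c (theta s)) s))
    ('D_(delta_mx 0 k) (fun x => L x (derive1 (fun s => c (theta s)) t)) (c (theta t)) +
     2 * derive1 theta t *
     ('D_(derive1 c (theta t)) (fun z => lin_form (b z) (delta_mx 0 k)) (c (theta t)) -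
      'D_(delta_mx 0 k) (fun z => lin_form (b z) (derive1 c (theta t))) (c (theta t)))).
Proof.
move=> EL k.
have [dc d2c [/= Ux y0]] := rc.
set v := delta_mx 0 k.
have dirE s : derive1 (fun s => c (theta s)) s = derive1 theta s *: derive1 c (theta s) ->
    derive1 (fun s => c (theta s)) s = (- derive1 theta s) *: - derive1 c (theta s).
  by rewrite scaleNr scalerN opprK.
have [Et [tn _]] := nbhs_singleton derive1_reversal.
have E : \forall s \near t, - 'D_v (L (c (theta s))) (derive1 c (theta s)) +
      2 *: lin_form (b (c (theta s))) v =
    'D_v (L (c (theta s))) (derive1 (fun s => c (theta s)) s).
  apply: filterS derive1_reversal => s [/dirE -> [sn [/= Us ys]]].
  by rewrite (derive_homogeneous oU sL) ?oppr_eq0 ?oppr_gt0// derive_opp_snd.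
apply: near_eq_is_derive E _.
have hth := derivableP (nbhs_singleton dtheta).
have D1 := is_derive_comp_scalar hth (EL k).
have Db : is_derive (theta t) 1 (fun s => lin_form (b (c s)) v)
    ('D_(derive1 c (theta t)) (fun z => lin_form (b z) v) (c (theta t))).
  apply: (is_derive_comp (f := fun z => lin_form (b z) v)).
    by rewrite derive1E; apply: derivableP; exact: nbhs_singleton dc.
  exact: smooth_differentiable (lin_form_smooth v) Ux.
have D2 := is_derive_comp_scalar hth Db.
have D3 := is_deriveD (is_deriveN D1) (is_deriveZ 2 D2).
have yn0 : - derive1 c (theta t) != 0 by rewrite oppr_eq0.
have tp : 0 < - derive1 theta t by rewrite oppr_gt0.
rewrite (dirE _ Et) (derive_homogeneous_fst oU sL L_homo _ Ux yn0 tp).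
rewrite (derive_opp_fst _ Ux y0).
apply: is_derive_eq D3 _.
rewrite -derive1E.
set p := derive1 theta t; set q := 'D_v _ _; set r := 'D_ _ _ _; set w := 'D_v _ _.
rewrite -[p *: q]/(p * q) -[p *: r]/(p * r) -[2 *: _]/(2 * _).
ring.
Qed.

End reversal.

(** * Invariance of the Euler-Lagrange equations under change of chart *)

Section chart_change.
Context {R : realType} {n : nat}.
Local Notation V := 'rV[R]_n.
Variables (O U : set V) (L L' : V -> V -> R) (K : V -> V).
Hypotheses (oO : open O) (oU : open U) (sK : smooth_on O K)
  (sL : smooth_on (slit U) (joint L)).
Hypothesis KU : forall x, O x -> U (K x).
Hypothesis L'E : forall x y, O x -> L' x y = L (K x) ('D_y K x).
Variables (c : R -> V) (t : R).
Hypotheses (dc : derivable c t 1) (Oc : \forall s \near t, O (c s))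
  (dcn : \forall s \near t, derivable c s 1).
Hypothesis (rKc : regular_at U (fun s => K (c s)) t).

Let dL p : slit U p -> differentiable (joint L) p.
Proof. by apply: smooth_differentiable => //; exact: open_slit. Qed.

Let dK x : O x -> differentiable K x.
Proof. by move=> Ox; exact: smooth_differentiable_vec Ox. Qed.

Let sKl (l : 'I_n) : smooth_on O (fun x => K x 0 l).
Proof. exact: ((smooth_fcoord K oO).2 sK l). Qed.

Let derive_Kl x v (l : 'I_n) : O x -> ('D_v K x) 0 l = 'D_v (fun x => K x 0 l) x.
Proof.
move=> Ox; apply: esym.
exact: (derive_fcoord (fV := finite_dim_rV R n) l (diff_derivable (dK Ox))).
Qed.

Lemma derive1_chart : \forall s \near t,
  derive1 (fun s => K (c s)) s = 'D_(derive1 c s) K (c s).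
Proof.
apply: filterS (filterI Oc dcn) => s [Os ds].
rewrite !derive1E; apply: derive_val.
exact: is_derive_comp (derivableP ds) (dK Os).
Qed.

Let is_derive_dK x y v : O x -> is_derive y v (fun z => 'D_z K x) ('D_v K x).
Proof.
move=> Ox; have d := dK Ox.
have -> : (fun z => 'D_z K x) = 'd K x by apply/funext => z; exact: deriveE.
rewrite (deriveE v d); exact: (is_derive_linear y v (diff_continuous d)).
Qed.

Lemma derive_chart_snd x y v : O x -> 'D_y K x != 0 ->
  'D_v (L' x) y = \sum_l 'D_v (fun x => K x 0 l) x *
    'D_(delta_mx 0 l) (L (K x)) ('D_y K x).
Proof.
move=> Ox y0.
have d : differentiable (L (K x)) ('D_y K x).
  by apply: differentiable_joint_snd; apply: dL; split => //; exact: KU.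
have -> : L' x = fun z => L (K x) ('D_z K x) by apply/funext => z; rewrite L'E.
have D := is_derive_comp (is_derive_dK y v Ox) d.
rewrite (@derive_val _ _ _ _ _ _ _ D) derive_delta//.
by apply: eq_bigr => l _; rewrite derive_Kl.
Qed.

(** The point x enters L(K x, ['D_y K x]) twice; the second occurrence produces the terms with
    second derivatives of [K]. *)
Lemma derive_chart_fst x y v : O x -> 'D_y K x != 0 ->
  'D_v (fun z => L' z y) x = \sum_l ('D_v (fun x => K x 0 l) x *
    'D_(delta_mx 0 l) (fun z => L z ('D_y K x)) (K x) +
    'D_v ('D_y (fun x => K x 0 l)) x * 'D_(delta_mx 0 l) (L (K x)) ('D_y K x)).
Proof.
move=> Ox y0.
have W : slit U (K x, 'D_y K x) by split => //; exact: KU.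
have d2K : derivable ('D_y K) x v.
  by apply: smooth_derivable Ox; exact: smooth_derive.
have D1 : is_derive x v (fun z => (K z, 'D_y K z)) ('D_v K x, 'D_v ('D_y K) x).
  apply/is_derive1P; apply: is_derive_pair.
    exact: (is_derive1P K x v _).1 (derivableP (diff_derivable (dK Ox))).
  exact: (is_derive1P ('D_y K) x v _).1 (derivableP d2K).
have D := is_derive_comp (f := joint L) D1 (dL W).
rewrite (_ : 'D_v _ x = 'D_('D_v K x, 'D_v ('D_y K) x) (joint L) (K x, 'D_y K x));
  last first.
  rewrite -(@derive_val _ _ _ _ _ _ _ D); apply: near_eq_derive.
  by apply: filterS (open_near oO Ox) => z Oz; rewrite L'E.
rewrite (derive_pair_dir _ _ (dL W)) -derive_joint_snd -derive_joint_fst.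
rewrite [X in X + _]derive_delta; last exact: differentiable_joint_fst (dL W).
rewrite [X in _ + X]derive_delta; last exact: differentiable_joint_snd (dL W).
rewrite -big_split; apply: eq_bigr => l _ /=; rewrite derive_Kl//; congr (_ + _ * _).
apply: etrans (esym (derive_fcoord (fV := finite_dim_rV R n) l d2K)) _.
apply: near_eq_derive; apply: filterS (open_near oO Ox) => z Oz.
by rewrite -derive_Kl.
Qed.

(* The second derivatives of [K] produced on both sides agree by Schwarz. *)
Lemma euler_lagrange_chart : euler_lagrange L (fun s => K (c s)) t ->
  euler_lagrange L' c t.
Proof.
move=> EL k; set v := delta_mx 0 k.
have O0 : O (c t) := nbhs_singleton Oc.
have [_ _ [/= _ y0]] := rKc.
(* Momenta transform as covectors, by the transposed differential of [K]. *)
have E : \forall s \near t, \sum_l 'D_v (fun x => K x 0 l) (c s) *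
    'D_(delta_mx 0 l) (L (K (c s))) (derive1 (fun s => K (c s)) s) =
    'D_v (L' (c s)) (derive1 c s).
  apply: filterS (filterI (filterI Oc derive1_chart) (near_slit oU rKc)) =>
    s [[Os Es] [_ /= ys]].
  rewrite Es in ys *; by rewrite derive_chart_snd.
apply: near_eq_is_derive E _.
have y0' : 'D_(derive1 c t) K (c t) != 0 by rewrite -(nbhs_singleton derive1_chart).
rewrite (derive_chart_fst v O0 y0').
rewrite -(nbhs_singleton derive1_chart).
have Dc : is_derive t 1 c (derive1 c t) by rewrite derive1E; exact: derivableP.
apply: is_derive_sum_fun => l.
have D1 : is_derive t 1 (fun s => 'D_v (fun x => K x 0 l) (c s))
    ('D_v ('D_(derive1 c t) (fun x => K x 0 l)) (c t)).
  rewrite (derive_comm oO (derive1 c t) v (sKl l) O0).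
  exact: (is_derive_comp Dc (smooth_differentiable oO (smooth_derive v (sKl l)) O0)).
have Q := is_deriveM_fun D1 (EL l).
by rewrite addrC in Q.
Qed.

End chart_change.

(** * Existence of geodesics *)

Section smooth_matrix.
Variables (R : realType) (W : normedModType R) (O : set W).
Hypothesis oO : open O.

Lemma smooth_det m (A : W -> 'M[R]_m) :
  (forall i j, smooth_on O (fun x => A x i j)) -> smooth_on O (fun x => \det (A x)).
Proof.
move=> sA; apply: (smooth_sum oO) => s; apply: (smoothM oO).
  exact: smooth_cst.
by apply: (smooth_prod oO) => i; exact: sA.
Qed.

Lemma smooth_cofactor m (A : W -> 'M[R]_m) i j :
  (forall i j, smooth_on O (fun x => A x i j)) ->
  smooth_on O (fun x => cofactor (A x) i j).
Proof.
move=> sA; apply: (smoothM oO); first exact: smooth_cst.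
apply: smooth_det => k l; under eq_fun do rewrite !mxE; exact: sA.
Qed.

(** By Cramer's rule the entries are cofactors divided by the determinant. *)
Lemma smooth_invmx m (A : W -> 'M[R]_m) i j :
  (forall x, O x -> A x \in unitmx) ->
  (forall i j, smooth_on O (fun x => A x i j)) ->
  smooth_on O (fun x => invmx (A x) i j).
Proof.
move=> uA sA.
apply: (eq_smooth oO (f := fun x => (\det (A x))^-1 * cofactor (A x) j i)).
  by move=> x Ox; rewrite /invmx uA// !mxE.
apply: (smoothM oO); last exact: smooth_cofactor.
apply: (smoothV oO); last exact: smooth_det.
by move=> x /uA; rewrite unitmxE unitfE.
Qed.

End smooth_matrix.

(** * The geodesic spray *)

Section spray.
Context {R : realType} {n : nat}.
Local Notation V := 'rV[R]_n.
Variables (U : set V) (E : V -> V -> R).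
Hypotheses (oU : open U) (sE : smooth_on (slit U) (joint E)).
Hypothesis E_convex : forall x y v, U x -> y != 0 -> v != 0 ->
  0 < 'D_(0, v) ('D_(0, v) (joint E)) (x, y).

Let P k := 'D_(0, delta_mx 0 k) (joint E).

Let sP k : smooth_on (slit U) (P k).
Proof. exact: smooth_derive. Qed.

Let oS : open (slit U). Proof. exact: open_slit. Qed.

Let dP k p : slit U p -> differentiable (P k) p.
Proof. exact: (smooth_differentiable oS (sP k)). Qed.

Definition hessian (p : V * V) : 'M[R]_n :=
  \matrix_(k, l) 'D_(0, delta_mx 0 l) ('D_(0, delta_mx 0 k) (joint E)) p.

(** Expanding d/dt E_{y^k} = E_{x^k} by the chain rule, [hessian] applied to c'' equals this column,
    which collects the terms free of c''. *)
Definition spray_rhs (p : V * V) : 'cV[R]_n :=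
  \col_k ('D_(delta_mx 0 k, 0) (joint E) p -
    \sum_j p.2 0 j * 'D_(delta_mx 0 j, 0) ('D_(0, delta_mx 0 k) (joint E)) p).

(** The value of c'' imposed by the Euler-Lagrange equations, transposed because tangent vectors are
    rows. *)
Definition acceleration (p : V * V) : V := (invmx (hessian p) *m spray_rhs p)^T.

(** A row v in the kernel has v H v^T = 0; but this number is the second derivative of [E] along (0,
    v), positive by convexity when v is nonzero. *)
Lemma hessian_unitmx p : slit U p -> hessian p \in unitmx.
Proof.
move=> Sp; rewrite -row_free_unit -kermx_eq0; apply/rowV0P => v /sub_kermxP vH.
apply/eqP/negPn/negP => v0.
have : (v *m hessian p *m v^T) 0 0 = 0 by rewrite vH mul0mx mxE.
suff -> : (v *m hessian p *m v^T) 0 0 = 'D_(0, v) ('D_(0, v) (joint E)) p.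
  case: p Sp {vH} => x y [/= Ux y0] /eqP.
  by rewrite gt_eqF// E_convex.
have D : is_derive p (0, v) (fun q => \sum_k v 0 k * P k q)
    (\sum_k v 0 k *: 'D_(0, v) (P k) p).
  apply: is_derive_sum_fun => k; apply: is_deriveZ.
  exact: derivableP (diff_derivable (dP k Sp)).
have -> : 'D_(0, v) ('D_(0, v) (joint E)) p = \sum_k v 0 k *: 'D_(0, v) (P k) p.
  rewrite -(@derive_val _ _ _ _ _ _ _ D); apply: near_eq_derive.
  apply: filterS (open_near oS Sp) => q Sq.
  exact: derive_delta_snd (smooth_differentiable oS sE Sq).
rewrite mxE; under eq_bigr do rewrite !mxE mulr_suml.
rewrite exchange_big; apply: eq_bigr => k _ /=.
rewrite (derive_delta_snd _ (dP k Sp)) scaler_sumr; apply: eq_bigr => l _.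
by rewrite mxE -[RHS]/(_ * (_ * _)) mulrAC mulrA.
Qed.

Lemma smooth_acceleration k : smooth_on (slit U) (fun p => acceleration p 0 k).
Proof.
apply: (eq_smooth oS (f := fun p => \sum_j invmx (hessian p) k j * spray_rhs p j 0)).
  by move=> p _; rewrite !mxE.
apply: (smooth_sum oS) => j; apply: (smoothM oS).
  apply: (smooth_invmx oS); first exact: hessian_unitmx.
  move=> a b; under eq_fun do rewrite mxE.
  exact: (smooth_derive (0, delta_mx 0 b) (sP a)).
under eq_fun do rewrite mxE.
apply: (smoothB oS); first exact: (smooth_derive (delta_mx 0 j, 0) sE).
apply: (smooth_sum oS) => a; apply: (smoothM oS); last first.
  exact: (smooth_derive (delta_mx 0 a, 0) (sP j)).
have -> : (fun p : V * V => p.2 0 a) =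
    fcoord (finite_dim := finite_dim_prod (finite_dim_rV R n) (finite_dim_rV R n))
      (unsplit (inr a)).
  by apply/funext => p; rewrite fcoord_inr.
exact: smooth_coord.
Qed.

Lemma smooth_spray : smooth_on (slit U) (fun p => (p.2, acceleration p)).
Proof.
apply/(smooth_fcoord (fW := finite_dim_prod (finite_dim_rV R n) (finite_dim_rV R n)) _
  oS) => i.
rewrite /=; case: (fintype.split i) => a /=; last exact: smooth_acceleration.
have -> : (fun p : V * V => p.2 0 a) =
    fcoord (finite_dim := finite_dim_prod (finite_dim_rV R n) (finite_dim_rV R n))
      (unsplit (inr a)).
  by apply/funext => p; rewrite fcoord_inr.
exact: smooth_coord.
Qed.

Lemma hessian_acceleration p k : slit U p ->
  \sum_l acceleration p 0 l * 'D_(0, delta_mx 0 l) ('D_(0, delta_mx 0 k) (joint E)) p =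
  spray_rhs p k 0.
Proof.
move=> /hessian_unitmx uH.
have -> : spray_rhs p = hessian p *m (acceleration p)^T.
  by rewrite /acceleration trmxK mulKVmx.
rewrite mxE; apply: eq_bigr => l _.
by rewrite [X in _ = X * _]mxE [X in _ = _ * X]mxE mulrC.
Qed.

Let open_norm_lt (d : R) : open [set t : R | `|t| < d].
Proof. by rewrite openE => t /= td; exact: near_norm_lt. Qed.

(** An integral curve of the field (y, acceleration) on the slit tangent bundle has as second
    component the derivative of the first, nonzero throughout; the equation for that component is
    the Euler-Lagrange system. *)
Lemma euler_lagrange_exists x0 y0 : U x0 -> y0 != 0 ->
  exists2 d : R, 0 < d & exists z : R -> V,
    [/\ z 0 = x0, derive1 z 0 = y0, smooth_on [set t : R | `|t| < d] z &
      forall t : R, `|t| < d -> slit U (z t, derive1 z t) /\ euler_lagrange E z t].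
Proof.
move=> Ux0 y00.
have [d d0 [w [w0 Hw]]] := smooth_ode_exists oS smooth_spray (z0 := (x0, y0))
  (conj Ux0 y00).
exists d => //; exists (fun t => (w t).1).
have dw (t : R) : `|t| < d -> is_derive t 1 (fun s => (w s).1) (w t).2.
  move=> /Hw[_ /(is_derive_fcoord (fV := finite_dim_prod (finite_dim_rV R n)
    (finite_dim_rV R n))) H].
  apply/(is_derive_fcoord (fV := finite_dim_rV R n)) => k.
  have := H (unsplit (inl k)); rewrite fcoord_inl.
  by under eq_fun do rewrite fcoord_inl.
have z'E (t : R) : `|t| < d -> derive1 (fun s => (w s).1) t = (w t).2.
  by move=> /dw D; rewrite derive1E; exact: derive_val.
have H0 : `|0 : R| < d by rewrite normr0.
split.
- by rewrite w0.
- by rewrite z'E// w0.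
- have sw : smooth_on [set t : R | `|t| < d] w.
    apply: (smooth_ode (open_norm_lt (d := d)) oS smooth_spray).
      by move=> t /Hw[].
    by move=> t /Hw[].
  apply/(smooth_fcoord (fW := finite_dim_rV R n) _ (open_norm_lt (d := d))) => k.
  have -> : (fun t => fcoord k (w t).1) = (fun t =>
      fcoord (finite_dim := finite_dim_prod (finite_dim_rV R n) (finite_dim_rV R n))
        (unsplit (inl k)) (w t)) by apply/funext => t; rewrite fcoord_inl.
  exact: ((smooth_fcoord (fW := finite_dim_prod (finite_dim_rV R n) (finite_dim_rV R n)) w
    (open_norm_lt (d := d))).2 sw (unsplit (inl k))).
move=> t td; have [St dwt] := Hw t td.
rewrite (z'E _ td); split; first by case: (w t) St.
move=> k.
have Ek : \forall s \near t, P k (w s) =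
    'D_(delta_mx 0 k) (E (w s).1) (derive1 (fun s => (w s).1) s).
  apply: filterS (near_norm_lt td) => s sd.
  by rewrite (z'E _ sd) derive_joint_snd -surjective_pairing.
apply: near_eq_is_derive Ek _.
have D := is_derive_comp dwt (dP k St).
rewrite (derive_pair_dir _ _ (dP k St)) in D.
rewrite (z'E _ td) derive_joint_fst -surjective_pairing.
apply: is_derive_eq D _.
rewrite (derive_delta_fst _ (dP k St)) (derive_delta_snd _ (dP k St)).
have H := hessian_acceleration k St; rewrite [RHS]mxE in H.
have T (a b c : R) : b = c - a -> a + b = c by move=> ->; rewrite addrC subrK.
exact: T H.
Qed.

End spray.

Lemma open_locally (T : topologicalType) (S : set T) :
  (forall x, S x -> \forall y \near x, S y) -> open S.
Proof. by move=> H; rewrite openE => x /H. Qed.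

Section inverse_parameter.
Variable R : realType.

(* [theta] inverts the antiderivative of [h], normalized so that it runs from 1
   to 0 on the unit interval. *)
Lemma reversing_parameter (h : R -> R) (e : R) : 0 < e ->
  smooth_on `]- e, 1 + e[ h -> (forall t, - e < t < 1 + e -> 0 < h t) ->
  exists K d : R, exists theta : R -> R,
    [/\ 0 < K /\ 0 < d, theta 0 = 1 /\ theta 1 = 0, smooth_on `]- d, 1 + d[ theta,
      forall t, - d < t < 1 + d -> - e < theta t < 1 + e /\
        is_derive t 1 theta (- K / h (theta t)) &
      forall t, 0 <= t <= 1 -> 0 <= theta t <= 1].
Proof.
move=> e0 sh h0.
have inO (t : R) : (- e < t < 1 + e) = (`]- e, 1 + e[%classic t) :> Prop.
  by rewrite /= in_itv.
have oO : open (`]- e, 1 + e[%classic : set R) by exact: interval_open.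
(* The projection onto [-e/2, 1 + e/2], centred at 1/2, makes [h] continuous on the whole line. *)
pose q (t : R) := 2^-1 + clamp (2^-1 + e / 2) (t - 2^-1).
have r0 : 0 <= 2^-1 + e / 2 by rewrite addr_ge0// ?invr_ge0// divr_ge0// ltW.
have q_in (t : R) : - e < q t < 1 + e.
  have := clamp_le (t - 2^-1) r0; rewrite ler_norml => /andP[h1 h2].
  by rewrite /q; apply/andP; split; lra.
have q_id (t : R) : - (e / 2) <= t <= 1 + e / 2 -> q t = t.
  move=> /andP[h1 h2]; rewrite /q clamp_id; first by rewrite addrC subrK.
  by rewrite ler_norml; apply/andP; split; lra.
have cq : continuous q.
  move=> t; apply/cvgrPdist_lt => x x0; near=> s.
  rewrite /q opprD addrACA subrr add0r.
  apply: le_lt_trans (clamp_lipschitz _ _ _) _.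
  rewrite opprB addrA subrK; near: s; exact: cvgr_dist_lt.
have ch : continuous (fun t => h (q t)).
  move=> t; apply: (@continuous_comp _ _ _ q h).
    exact: cq.
  by apply: (smooth_continuous sh); rewrite -inO.
(* The interval is wider by 1 on each side, so that [G] has a derivative at the ends of
   [-e/2, 1 + e/2] too. *)
have [G HG] := continuous_antiderivative (- (e / 2) - 1) (2 + e / 2) ch.
have dG (t : R) : - (e / 2) <= t <= 1 + e / 2 -> is_derive t 1 G (h t).
  move=> t01; rewrite -{2}(q_id _ t01); apply: HG.
  by case/andP: t01 => ? ?; apply/andP; split; lra.
have G_incr (a b : R) : - (e / 2) <= a -> a < b -> b <= 1 + e / 2 -> G a < G b.
  move=> ha ab hb; rewrite -subr_gt0.
  have [||x] := @MVT R G h a b ab.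
  - by move=> x; rewrite in_itv/= => /andP[h1 h2]; apply: dG; apply/andP; split; lra.
  - apply: derivable_within_continuous => x; rewrite in_itv/= => /andP[h1 h2].
    have D : is_derive x 1 G (h x) by apply: dG; apply/andP; split; lra.
    exact: (@ex_derive _ _ _ _ _ _ _ D).
  rewrite in_itv/= => /andP[h1 h2] ->; rewrite mulr_gt0 ?subr_gt0//.
  by apply: h0; apply/andP; split; lra.
have G_inj (a b : R) : - (e / 2) <= a <= 1 + e / 2 -> - (e / 2) <= b <= 1 + e / 2 ->
    G a <= G b -> a <= b.
  move=> /andP[a1 a2] /andP[b1 b2]; rewrite leNgt => Gab.
  by rewrite leNgt; apply: contra Gab => ba; exact: G_incr.
have inv_exists (v : R) : exists y : R, G (- (e / 2)) < v < G (1 + e / 2) ->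
    - (e / 2) < y < 1 + e / 2 /\ G y = v.
  have [/andP[v1 v2]|nv] := boolP (G (- (e / 2)) < v < G (1 + e / 2)); last by exists 0.
  have [|||y] := @IVT R G (- (e / 2)) (1 + e / 2) v.
  - by lra.
  - apply: derivable_within_continuous => x; rewrite in_itv/= => x01.
    exact: (@ex_derive _ _ _ _ _ _ _ (dG x x01)).
  - by rewrite ge_min le_max (ltW v1) (ltW v2) orbT.
  rewrite in_itv/= => /andP[y1 y2] Gy; exists y => _; split => //.
  rewrite !lt_neqAle y1 y2 !andbT; apply/andP; split; apply/eqP => E.
    by move: v1; rewrite -Gy -E ltxx.
  by move: v2; rewrite -Gy E ltxx.
have [g Hg] := choice inv_exists.
have gK (y : R) : - (e / 2) < y < 1 + e / 2 -> g (G y) = y.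
  move=> /andP[y1 y2].
  have Gy : G (- (e / 2)) < G y < G (1 + e / 2) by rewrite !G_incr// ?ltW//; lra.
  have [/andP[g1 g2] E] := Hg _ Gy.
  have i1 : - (e / 2) <= g (G y) <= 1 + e / 2 by apply/andP; split; exact: ltW.
  have i2 : - (e / 2) <= y <= 1 + e / 2 by apply/andP; split; exact: ltW.
  have l1 : g (G y) <= y by apply: (G_inj _ _ i1 i2); rewrite E.
  have l2 : y <= g (G y) by apply: (G_inj _ _ i2 i1); rewrite E.
  by apply: le_anti; rewrite l1 l2.
have dg (y : R) : - (e / 2) < y < 1 + e / 2 -> is_derive (G y) 1 g (h y)^-1.
  move=> y01.
  have ny : \forall z \near y, - (e / 2) < z < 1 + e / 2.
    have := @interval_open R (BRight (- (e / 2))) (BLeft (1 + e / 2)) isT isT.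
    rewrite openE => /(_ y); rewrite /= in_itv/= => /(_ y01).
    by apply: filterS => z; rewrite /= in_itv.
  apply: (@is_derive_inverse R G).
  - by apply: filterS ny => z; exact: gK.
  - apply: filterS ny => z /andP[z1 z2].
    apply: differentiable_continuous; apply/derivable1_diffP.
    have D : is_derive z 1 G (h z) by apply: dG; rewrite !ltW.
    exact: (@ex_derive _ _ _ _ _ _ _ D).
  - by apply: dG; case/andP: y01 => ? ?; rewrite !ltW.
  - by rewrite gt_eqF// h0//; case/andP: y01 => ? ?; apply/andP; split; lra.
pose K := G 1 - G 0.
have K0 : 0 < K by rewrite subr_gt0 G_incr//; lra.
(* The room left in the range of [G] below G 0 and above G 1; with d = m / K, the values G 0 + K (1
   - t) stay in this range for -d < t < 1 + d. *)
pose m := Num.min (G 0 - G (- (e / 2))) (G (1 + e / 2) - G 1).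
have m0 : 0 < m by rewrite lt_min !subr_gt0 !G_incr//; lra.
pose d := m / K.
have d0 : 0 < d by rewrite divr_gt0.
have dK : d * K = m by rewrite divfK// gt_eqF.
(* [G] is made to run affinely from G 1 down to G 0, so differentiating G (theta t) gives h(theta)
   theta' = -K. *)
pose theta t := g (G 0 + K * (1 - t)).
have range (t : R) : - d < t < 1 + d ->
    G (- (e / 2)) < G 0 + K * (1 - t) < G (1 + e / 2).
  move=> /andP[t1 t2].
  have m1 : m <= G 0 - G (- (e / 2)) by rewrite ge_min lexx.
  have m2 : m <= G (1 + e / 2) - G 1 by rewrite ge_min lexx orbT.
  have h1 : K * (- d) < K * t by rewrite ltr_pM2l.
  have h2 : K * t < K * (1 + d) by rewrite ltr_pM2l.
  rewrite mulrN [K * d]mulrC dK in h1; rewrite mulrDr mulr1 [K * d]mulrC dK in h2.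
  by rewrite mulrBr mulr1; apply/andP; split; rewrite /K in h1 h2 *; lra.
have dtheta (t : R) : - d < t < 1 + d ->
    - (e / 2) < theta t < 1 + e / 2 /\ is_derive t 1 theta (- K / h (theta t)).
  move=> td; have [th Gth] := Hg _ (range t td); split => //.
  have D : is_derive t 1 (fun t : R => G 0 + K * (1 - t)) (- K).
    have -> : - K = 0 + K *: (0 - 1) by rewrite add0r sub0r scalerN [K *: 1]mulr1.
    have D1 : is_derive t 1 (fun t : R => 1 - t) (0 - 1).
      exact: is_deriveB.
    by apply: is_deriveD; apply: is_deriveZ.
  have := is_derive_comp_scalar D; rewrite -Gth; apply; exact: dg.
have E1 : theta 0 = 1.
  by rewrite /theta subr0 mulr1 /K addrC subrK gK//; lra.
have E0 : theta 1 = 0.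
  by rewrite /theta subrr mulr0 addr0 gK//; lra.
exists K, d, theta; split => //.
- pose U := `](- (e / 2)), (1 + e / 2)[%classic : set R.
  have oU : open U by exact: interval_open.
  have sU : smooth_on U (fun y => (- K) * (h y)^-1).
    apply: (smoothM oU (smooth_cst oU (- K))).
    apply: (smoothV oU) => [x|].
      by rewrite /U/= in_itv/= => /andP[? ?]; rewrite gt_eqF// h0//; apply/andP; split; lra.
    apply: smooth_subset sh => x; rewrite /U/= !in_itv/= => /andP[? ?].
    by apply/andP; split; lra.
  (* Smoothness of [theta] follows from the autonomous equation theta' = -K / h(theta) that it
     satisfies. *)
  apply: (smooth_ode (V := R) (fV := finite_dim_R R) _ oU sU).
  + exact: interval_open.
  + by move=> t; rewrite /= in_itv/= => /dtheta[]; rewrite /U/= in_itv.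
  + by move=> t; rewrite /= in_itv/= => /dtheta[].
- move=> t /dtheta[/andP[h1 h2] D]; split => //.
  by apply/andP; split; lra.
move=> t /andP[t0 t1].
have td : - d < t < 1 + d by apply/andP; split; lra.
have [th Gth] := Hg _ (range t td).
have thi : - (e / 2) <= theta t <= 1 + e / 2 by case/andP: th => ? ?; rewrite !ltW.
have Gt : G (theta t) = G 0 + K * (1 - t) := Gth.
have i0 : - (e / 2) <= 0 <= 1 + e / 2 by apply/andP; split; lra.
have i1 : - (e / 2) <= 1 <= 1 + e / 2 by apply/andP; split; lra.
have ge0 : 0 <= K * (1 - t) by apply: mulr_ge0; [exact: ltW|rewrite subr_ge0].
have le1 : K * (1 - t) <= K * 1 by apply: ler_wpM2l; [exact: ltW|rewrite gerBl].
apply/andP; split; first by apply: (G_inj _ _ i0 thi); rewrite Gt lerDl.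
apply: (G_inj _ _ thi i1); rewrite Gt -[leRHS](subrK (G 0)) addrC lerD2r.
by apply: le_trans le1 _; rewrite mulr1.
Unshelve. all: by end_near. Qed.

End inverse_parameter.

(** * Curves on the manifold read in charts *)

Section curves.
Context {R : realType} {n : nat} {M : topologicalType} (A : smooth_atlas R n M).
Local Notation V := 'rV[R]_n.

Lemma open_overlap i j : open (overlap (A := A) i j).
Proof.
apply: open_locally => x [p [pi pj] <-].
have ximg : chart_img (A := A) i (chart_map A i p) by exists p.
have ci := chart_inv_continuous ximg.
have inv := chart_mapK pi.
have H : \forall y \near chart_map A i p, chart_dom A j (chart_inv A i y).
  by apply: (near_comp ci); rewrite inv; exact: open_near (chart_dom_open j) pj.
have H2 : \forall y \near chart_map A i p, chart_img (A := A) i y.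
  exact: open_near (@chart_img_open R n M A i) ximg.
near=> y.
have yj : chart_dom A j (chart_inv A i y) by near: y.
have [q qi qy] : chart_img (A := A) i y by near: y.
by exists q => //; split => //; rewrite -(chart_mapK qi) qy.
Unshelve. all: by end_near. Qed.

Variables (O : set R) (c : R -> M).
Hypotheses (oO : open O) (sc : smooth_curve A O c).

Definition visits i : set R := O `&` (c @^-1` chart_dom A i).

Definition local_curve i : R -> V := chart_map A i \o c.

Lemma open_visits i : open (visits i).
Proof.
apply: open_locally => t [Ot it].
have H := near_comp (sc.1 t Ot) (open_near (chart_dom_open i) it).
exact: filterI (open_near oO Ot) H.
Qed.

Lemma smooth_local_curve i : smooth_on (visits i) (local_curve i).
Proof. exact: sc.2 i. Qed.

Lemma derivable_local_curve i t : visits i t -> derivable (local_curve i) t 1.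
Proof. by move=> it; exact: smooth_derivable (@smooth_local_curve i) it. Qed.

Lemma derivable2_local_curve i t :
  visits i t -> derivable (derive1 (local_curve i)) t 1.
Proof.
move=> it; have -> : derive1 (local_curve i) = 'D_1 (local_curve i).
  by apply/funext => s; rewrite derive1E.
have s1 : smooth_on (visits i) ('D_1 (local_curve i)).
  by apply: smooth_derive; exact: smooth_local_curve.
exact: smooth_derivable s1 it.
Qed.

Lemma chart_img_local_curve i t : visits i t -> chart_img (A := A) i (local_curve i t).
Proof. by move=> [_ it]; exists (c t). Qed.

Lemma regular_local_curve i t : visits i t -> derive1 (local_curve i) t != 0 ->
  regular_at (chart_img (A := A) i) (local_curve i) t.
Proof.
move=> it c0; split.
- by apply: filterS (open_near (@open_visits i) it) => s; exact: derivable_local_curve.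
- exact: derivable2_local_curve.
- by split => //; exact: chart_img_local_curve.
Qed.

Lemma local_curve_transition i j t : visits i t ->
  local_curve j t = transition i j (local_curve i t).
Proof. by move=> [_ it]; rewrite /transition /local_curve/= chart_mapK. Qed.

Lemma overlap_local_curve i j t : visits i t -> visits j t ->
  overlap i j (local_curve i t).
Proof. by move=> [_ it] [_ jt]; exists (c t). Qed.

Lemma differentiable_transition i j x : overlap i j x ->
  differentiable (transition (A := A) i j) x.
Proof.
move=> ox; apply: (smooth_differentiable_vec (@open_overlap i j)) ox.
exact: chart_transition_smooth.
Qed.

Lemma derive1_local_curve i j t : visits i t -> visits j t ->
  derive1 (local_curve j) t = 'D_(derive1 (local_curve i) t) (transition i j)
    (local_curve i t).
Proof.
move=> it jt.
have D := is_derive_comp (derivableP (derivable_local_curve it))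
  (differentiable_transition (overlap_local_curve it jt)).
rewrite derive1E [in RHS]derive1E -(@derive_val _ _ _ _ _ _ _ D).
apply: near_eq_derive; apply: filterS (open_near (@open_visits i) it) => s.
exact: local_curve_transition.
Qed.

Lemma derive1_local_curve_neq0 i j t : visits i t -> visits j t ->
  derive1 (local_curve i) t != 0 -> derive1 (local_curve j) t != 0.
Proof.
move=> it jt; apply: contraNN => /eqP c0.
by rewrite (derive1_local_curve jt it) c0 derive0.
Qed.

End curves.

Section near_curves.
Context {R : realType} {n : nat}.
Local Notation V := 'rV[R]_n.
Variables (c1 c2 : R -> V) (t : R).
Hypothesis c12 : \forall s \near t, c1 s = c2 s.

Let near_c12 : \forall s \near t, \forall u \near s, c1 u = c2 u.
Proof. exact: near_join. Qed.

Lemma near_derive1 : \forall s \near t, derive1 c1 s = derive1 c2 s.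
Proof.
by apply: filterS near_c12 => s H; rewrite !derive1E; exact: near_eq_derive.
Qed.

(** Only the germ of the curve at [t] matters. This allows replacing a curve by its expression
    through another chart, which equals it only near [t]. *)
Lemma near_euler_lagrange (L : V -> V -> R) :
  euler_lagrange L c1 t -> euler_lagrange L c2 t.
Proof.
move=> EL k; rewrite -(nbhs_singleton near_derive1) -(nbhs_singleton c12).
apply: near_eq_is_derive (EL k).
by apply: filterS (filterI c12 near_derive1) => s [-> ->].
Qed.

Lemma near_regular_at (U : set V) : regular_at U c1 t -> regular_at U c2 t.
Proof.
move=> [d1 d2 W]; split.
- by apply: filterS (filterI near_c12 d1) => s [H]; exact: near_eq_derivable.
- exact: near_eq_derivable near_derive1 d2.
- by rewrite -(nbhs_singleton near_derive1) -(nbhs_singleton c12).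
Qed.

End near_curves.

Section smooth_vector.
Context {R : realType} {V : normedModType R}.
Variable O : set V.
Hypothesis oO : open O.

Lemma smooth_pair (W Z : normedModType R) (fW : finite_dim W) (fZ : finite_dim Z)
    (f : V -> W) (g : V -> Z) :
  smooth_on O f -> smooth_on O g -> smooth_on O (fun x => (f x, g x)).
Proof.
move=> sf sg; apply/(smooth_fcoord (fW := finite_dim_prod fW fZ) _ oO) => i.
rewrite -(splitK i); case: (fintype.split i) => a.
  by under eq_fun do rewrite fcoord_inl; exact: ((smooth_fcoord f oO).2 sf a).
by under eq_fun do rewrite fcoord_inr; exact: ((smooth_fcoord g oO).2 sg a).
Qed.

Lemma smoothN_vec (W : normedModType R) (fW : finite_dim W) (f : V -> W) :
  smooth_on O f -> smooth_on O (fun x => - f x).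
Proof.
move=> sf; apply/(smooth_fcoord (fW := fW) _ oO) => i.
under eq_fun do rewrite fcoordN.
by apply: (smoothN oO); exact: ((smooth_fcoord f oO).2 sf i).
Qed.

Lemma deriveN_dir (W : normedModType R) (f : V -> W) (x v : V) :
  differentiable f x -> 'D_(- v) f x = - 'D_v f x.
Proof. by move=> df; rewrite -scaleN1r (deriveZ_dir _ _ df) scaleN1r. Qed.

End smooth_vector.

(** Only margins at the two ends have to be found, the segment itself being covered. *)
Lemma segment_neighbourhood (R : realType) (S : set R) : open S ->
  (forall t : R, 0 <= t <= 1 -> S t) ->
  exists2 e : R, 0 < e & forall t : R, - e < t < 1 + e -> S t.
Proof.
move=> oS S01.
have /(@nbhs_ballP R R)[e0 /= e00 H0] : \forall s \near (0 : R), S s.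
  by apply: open_near oS _; apply: S01; rewrite lexx ler01.
have /(@nbhs_ballP R R)[e1 /= e10 H1] : \forall s \near (1 : R), S s.
  by apply: open_near oS _; apply: S01; rewrite lexx ler01.
exists (Num.min e0 e1); first by rewrite lt_min e00.
move=> t /andP[t0 t1].
have h0 : Num.min e0 e1 <= e0 by rewrite ge_min lexx.
have h1 : Num.min e0 e1 <= e1 by rewrite ge_min lexx orbT.
have [l0|l0] := leP 0 t; last first.
  by apply: H0; rewrite -ball_normE/= sub0r normrN ltr_norml; apply/andP; split; lra.
have [l1|l1] := leP t 1; first by apply: S01; rewrite l0.
by apply: H1; rewrite -ball_normE/= ltr_norml; apply/andP; split; lra.
Qed.

Section half_square_convex.
Context {R : realType} {n : nat}.
Local Notation V := 'rV[R]_n.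
Variables (U : set V) (L : V -> V -> R).
Hypotheses (oU : open U) (sL : smooth_on (slit U) (joint L)).

Lemma smooth_half_square : smooth_on (slit U) (joint (half_square L)).
Proof.
have oS := open_slit oU.
have s2 := smoothM oS (smooth_cst oS 2^-1) (smoothM oS sL sL).
by apply: (eq_smooth oS) s2 => p _; rewrite /joint /half_square expr2.
Qed.

(** In this form, with directions (0, v) on the product, strong convexity of a Finsler metric
    becomes the positivity that makes [hessian] invertible. *)
Lemma hessian_half_square (x y v : V) : U x -> y != 0 ->
  'D_(0, v) ('D_(0, v) (joint (half_square L))) (x, y) =
  2^-1 * 'D_v (fun z => 'D_v (fun w => L x w ^+ 2) z) y.
Proof.
move=> Ux y0.
have oS := open_slit oU.
pose Q (x y : V) := L x y ^+ 2.
have sQ : smooth_on (slit U) (joint Q).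
  by apply: (eq_smooth oS) (smoothM oS sL sL) => p _; rewrite /joint /Q expr2.
have S : slit U (x, y) by [].
have E : \forall p \near (x, y), 'D_(0, v) (joint (half_square L)) p =
    (2^-1 \*: 'D_(0, v) (joint Q)) p.
  apply: filterS (open_near oS S) => p Sp.
  have d : derivable (joint Q) p (0, v) by exact: smooth_derivable sQ Sp.
  exact: (@derive_val _ _ _ _ _ _ _ (is_deriveZ 2^-1 (derivableP d))).
rewrite (near_eq_derive _ E).
have d2 : derivable ('D_(0, v) (joint Q)) (x, y) (0, v).
  exact: smooth_derivable (smooth_derive (0, v) sQ) S.
rewrite (@derive_val _ _ _ _ _ _ _ (is_deriveZ 2^-1 (derivableP d2))).
have E1 : (fun z => 'D_v (fun w => L x w ^+ 2) z) = (fun z => 'D_(0, v) (joint Q) (x, z)).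
  by apply/funext => z; exact: derive_joint_snd Q x z v.
have E2 : joint (fun x z => 'D_(0, v) (joint Q) (x, z)) = 'D_(0, v) (joint Q).
  by apply/funext => -[].
have E3 := derive_joint_snd (fun x z => 'D_(0, v) (joint Q) (x, z)) x y v.
rewrite E2 in E3.
by rewrite E1 E3.
Qed.

End half_square_convex.

Section randers.
Context {R : realType} {n : nat} {M : topologicalType} (A : smooth_atlas R n M).
Local Notation V := 'rV[R]_n.

Lemma randers_opp (alpha : riemannian_metric A) (beta : one_form A) i (x y : V) :
  let F := randers_change (quartic_metric alpha beta) beta in
  F i x (- y) = F i x y - 2 * lin_form (form_coef beta i x) y.
Proof.
rewrite /randers_change /quartic_metric /metric_norm /form_fun /=.
have -> : quad_form (metric_coef alpha i x) (- y) = quad_form (metric_coef alpha i x) y.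
  by apply: eq_bigr => k _; apply: eq_bigr => l _; rewrite !mxE !mulrN mulNr opprK.
have -> : lin_form (form_coef beta i x) (- y) = - lin_form (form_coef beta i x) y.
  by rewrite /lin_form -sumrN; apply: eq_bigr => k _; rewrite mxE mulrN.
set b := lin_form _ y; have -> : (- b) ^+ 4 = b ^+ 4 by ring.
by set r := _ `^ _; ring.
Qed.

End randers.

(** * Reversibility *)

Section finsler_curves.
Context {R : realType} {n : nat} {M : topologicalType} (A : smooth_atlas R n M).
Local Notation V := 'rV[R]_n.
Variable F : local_expr A.
Hypothesis F_finsler : finsler_metric F.

Let U i : set V := chart_img (A := A) i.

Let oU i : open (U i). Proof. exact: chart_img_open. Qed.

Let sF i : smooth_on (slit (U i)) (joint (F i)).
Proof. exact: (finsler_smooth F_finsler). Qed.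

Lemma geodesicP (c : R -> M) : geodesic F c <->
  (exists2 e : R, 0 < e & smooth_curve A `]- e, 1 + e[ c) /\
  forall (t : R) i, 0 <= t <= 1 -> chart_dom A i (c t) ->
    derive1 (local_curve c i) t != 0 /\
    euler_lagrange (half_square (F i)) (local_curve c i) t.
Proof. by []. Qed.

Section backward_speed.
Variables (O : set R) (c : R -> M).
Hypotheses (oO : open O) (sc : smooth_curve A O c).

Let index (t : R) : chart A := sval (cid (chart_cover A (c t))).

Let indexP t : chart_dom A (index t) (c t).
Proof. exact: svalP (cid (chart_cover A (c t))). Qed.

(* F(c, - c'), computed in an arbitrary chart around c t *)
Definition backward_speed (t : R) : R :=
  F (index t) (local_curve c (index t) t) (- derive1 (local_curve c (index t)) t).

(** The chart chosen at each time varies arbitrarily with [t], so smoothness cannot be read off the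
    definition; as F is a function on the tangent bundle, a fixed chart may be used near each
    time. *)
Lemma backward_speedE i t : visits O c i t ->
  backward_speed t = F i (local_curve c i t) (- derive1 (local_curve c i) t).
Proof.
move=> it; have jt : visits O c (index t) t by split; [case: it|exact: indexP].
have ov := overlap_local_curve jt it.
rewrite /backward_speed (finsler_compat F_finsler (- derive1 (local_curve c (index t))
  t) ov).
rewrite (deriveN_dir _ (differentiable_transition ov)).
by rewrite -(derive1_local_curve oO sc jt it) -(local_curve_transition i jt).
Qed.

Definition regular_times : set R :=
  [set t | exists i : chart A, visits O c i t /\ derive1 (local_curve c i) t != 0].

Let regular_visits (i : chart A) : set R :=
  [set t | visits O c i t /\ derive1 (local_curve c i) t != 0].

Let open_regular_visits i : open (regular_visits i).
Proof.
apply: open_locally => t [it c0].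
have rc := regular_local_curve oO sc it c0.
near=> s; split; first by near: s; exact: open_near (open_visits oO sc (i := i)) it.
have : slit (U i) (local_curve c i s, derive1 (local_curve c i) s).
  by near: s; exact: near_slit.
by case.
Unshelve. all: by end_near. Qed.

Lemma open_regular_times : open regular_times.
Proof.
apply: open_locally => t [i it].
by apply: filterS (open_near (@open_regular_visits i) it) => s si; exists i.
Qed.

Lemma smooth_backward_speed : smooth_on regular_times backward_speed.
Proof.
apply: (smooth_bigcup (F := regular_visits)) => t [i it]; exists i => //.
have oi := @open_regular_visits i.
have sl : smooth_on (regular_visits i) (local_curve c i).
  apply: smooth_subset (smooth_local_curve sc (i := i)) => s.
  by case.
have sdl : smooth_on (regular_visits i) (derive1 (local_curve c i)).
  have -> : derive1 (local_curve c i) = 'D_1 (local_curve c i).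
    by apply/funext => s; rewrite derive1E.
  exact: smooth_derive.
apply: (eq_smooth oi (f := fun s => joint (F i) (local_curve c i s,
  - derive1 (local_curve c i) s))).
  by move=> s [si _]; rewrite (backward_speedE si).
apply: (smooth_comp (f := joint (F i)) oi (open_slit (@oU i)) _ _ (@sF i)).
  exact: (smooth_pair oi _ _ sl (smoothN_vec oi _ sdl)).
move=> s [si c0]; split; first exact: chart_img_local_curve si.
by rewrite /= oppr_eq0.
Qed.

Lemma backward_speed_gt0 t : regular_times t -> 0 < backward_speed t.
Proof.
move=> [i [it c0]]; rewrite (backward_speedE it).
apply: (finsler_pos F_finsler); first exact: chart_img_local_curve it.
by rewrite oppr_eq0.
Qed.

End backward_speed.

Variable b : one_form A.
Hypothesis F_opp : forall i x y, F i x (- y) = F i x y - 2 * lin_form (form_coef b i x) y.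

Let F_homo i x y (l : R) : U i x -> 0 < l -> F i x (l *: y) = l * F i x y.
Proof. exact: (finsler_homogeneous F_finsler). Qed.

Let F_pos i x y : U i x -> y != 0 -> 0 < F i x y.
Proof. exact: (finsler_pos F_finsler). Qed.

(** With h the backward speed of c and theta' = -K / h(theta), the reversed velocity has F-length
    -theta' h(theta) = K, which settles the speed equation. The equations of F itself hold up to a
    multiple of d beta(c', .), which vanishes. *)
Lemma closed_form_reversible : closed_form b -> reversible_geodesics F.
Proof.
move=> b_closed gam [phi [[ep ep0 sphi] phi0 phi1 dphi]] /geodesicP.
set c := gam \o phi => -[[ec ec0 sc] Hc].
pose Oc : set R := `]- ec, 1 + ec[%classic; pose Op : set R := `]- ep, 1 + ep[%classic.
have oOc : open Oc by exact: interval_open.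
have oOp : open Op by exact: interval_open.
have c_reg t : 0 <= t <= 1 -> regular_times Oc c t.
  move=> /andP[t0 t1]; have [i it] := chart_cover A (c t).
  exists i; split; last by have [] := Hc t i _ it; rewrite ?t0.
  by split => //; rewrite /Oc/= in_itv/=; apply/andP; split; lra.
(* A common margin around [0, 1] on which [phi] is smooth and the velocity of [c] does not
   vanish. *)
have [e e0 He] : exists2 e : R, 0 < e &
    forall t : R, - e < t < 1 + e -> (Op `&` regular_times Oc c) t.
  apply: segment_neighbourhood; first by apply: openI => //; exact: open_regular_times.
  move=> t t01; split; last exact: c_reg.
  by rewrite /Op/= in_itv/=; case/andP: t01 => ? ?; apply/andP; split; lra.
have [K [d [theta [[K0 d0] [th0 th1] sth dth th01]]]] :
    exists K d : R, exists theta : R -> R,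
    [/\ 0 < K /\ 0 < d, theta 0 = 1 /\ theta 1 = 0, smooth_on `]- d, 1 + d[ theta,
      forall t, - d < t < 1 + d -> - e < theta t < 1 + e /\
        is_derive t 1 theta (- K / backward_speed c (theta t)) &
      forall t, 0 <= t <= 1 -> 0 <= theta t <= 1].
  apply: reversing_parameter => //.
    apply: smooth_subset (smooth_backward_speed oOc sc) => t.
    by rewrite /= in_itv/= => /He[].
  by move=> t /He[_]; exact: (backward_speed_gt0 oOc sc).
pose O : set R := `]- d, 1 + d[%classic.
have oO : open O by exact: interval_open.
have OP t : O t -> - d < t < 1 + d by rewrite /O/= in_itv.
have O01 t : 0 <= t <= 1 -> O t.
  by move=> /andP[? ?]; rewrite /O/= in_itv/=; apply/andP; split; lra.
have dth1 t : O t -> derive1 theta t = - K / backward_speed c (theta t).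
  by move=> /OP /dth[_ D]; rewrite derive1E; exact: derive_val.
have th_decr t : O t -> derive1 theta t < 0.
  move=> Ot; have [/He[_ rt] _] := dth t (OP t Ot).
  by rewrite dth1// pmulr_llt0 ?oppr_lt0// invr_gt0 (backward_speed_gt0 oOc sc).
have thc t : O t -> {for t, continuous theta} by exact: smooth_continuous.
have thOc t : O t -> Oc (theta t).
  by move=> /OP /dth[/He[_ [i [[]]]]].
(* As [c] is [gam \o phi], this reparametrization turns t -> gam (1 - t) into [c] composed with
   [theta]; it increases because [phi] increases and [theta] decreases. *)
exists (fun t => 1 - phi (theta t)).
  split.
  - exists d; [by []|apply: (smoothB oO (smooth_cst oO 1))].
    apply: (smooth_comp (fW := finite_dim_R R) oO oOp sth _ sphi).
    by move=> t /OP /dth[/He[]].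
  - by rewrite th0 phi1 subrr.
  - by rewrite th1 phi0 subr0.
  move=> t t01; have Ot := O01 _ t01.
  have dphit : derivable phi (theta t) 1.
    by apply: smooth_derivable sphi _; have [/He[]] := dth t (OP t Ot).
  have D1 : is_derive t 1 (fun t => phi (theta t))
      (derive1 theta t *: derive1 phi (theta t)).
    rewrite !derive1E; apply: is_derive_comp_scalar (derivableP dphit).
    by apply: derivableP; exact: smooth_derivable sth Ot.
  have D : is_derive t 1 (fun t => 1 - phi (theta t))
      (0 - derive1 theta t *: derive1 phi (theta t)) by exact: is_deriveB.
  rewrite derive1E (@derive_val _ _ _ _ _ _ _ D) sub0r oppr_gt0.
  by rewrite pmulr_llt0 ?th_decr// dphi// th01.
have -> : (fun t => gam (1 - t)) \o (fun t => 1 - phi (theta t)) = (fun t => c (theta t)).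
  by apply/funext => t /=; rewrite subKr.
have dc t : O t -> {for t, continuous (fun t => c (theta t))}.
  move=> Ot; apply: (@continuous_comp _ _ _ theta c); first exact: thc.
  by apply: sc.1; exact: thOc.
apply/geodesicP; split.
  exists d => //; split => [t Ot|i]; first exact: dc.
  have oi : open (O `&` ((fun t => c (theta t)) @^-1` chart_dom A i)).
    apply: open_locally => t [Ot it].
    apply: filterI; first exact: open_near oO Ot.
    exact: (near_comp (dc t Ot) (open_near (chart_dom_open (s := A) i) it)).
  apply: (smooth_comp_vec (f := local_curve c i) oi (open_visits oOc sc (i := i)) _ _ _).
  - by apply: smooth_subset sth => t [].
  - by move=> t [Ot it]; split => //; exact: thOc.
  - exact: smooth_local_curve.
move=> t i t01 it; have Ot := O01 _ t01.
have vi : visits Oc c i (theta t) by split => //; exact: thOc.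
have [c0 EL] := Hc (theta t) i (th01 t t01) it.
have rc := regular_local_curve oOc sc vi c0.
have dthn : \forall s \near t, derivable theta s 1.
  by apply: filterS (open_near oO Ot) => s Os; exact: smooth_derivable sth Os.
have d2th : derivable (derive1 theta) t 1.
  have -> : derive1 theta = 'D_1 theta by apply/funext => s; rewrite derive1E.
  have s1 : smooth_on O ('D_1 theta) by exact: smooth_derive.
  exact: smooth_derivable s1 Ot.
have rd := regular_at_reversal (@oU i) rc dthn d2th (th_decr t Ot).
split; first by have [_ _ []] := rd.
have [D1 EL1] := (euler_lagrange_half_square (@oU i) (@sF i) (@F_homo i) (@F_pos i)
  rc).1 EL.
apply/(euler_lagrange_half_square (@oU i) (@sF i) (@F_homo i) (@F_pos i) rd).
split.
  (* The velocity is (-theta')(-c'), so by homogeneity its F-length is -theta' times the backward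
     speed, that is [K]. *)
  apply: (@near_eq_is_derive _ _ _ (cst K)).
  have dr := derive1_reversal (@oU i) rc dthn d2th (th_decr t Ot).
  have vn := near_comp (thc t Ot) (open_near (open_visits oOc sc (i := i)) vi).
  apply: filterS (filterI dr (filterI vn (open_near oO Ot))) =>
    s [[E [s0 [Us ys]]] [vs Os]].
  rewrite E -[derive1 theta s *: _]opprK -scaleNr -scalerN F_homo ?oppr_gt0//.
  rewrite -(backward_speedE oOc sc vs) (dth1 _ Os).
  have h0 : 0 < backward_speed c (theta s).
    by apply: (backward_speed_gt0 oOc sc); have [/He[]] := dth s (OP s Os).
  have T (k h : R) : h != 0 -> k = - (- k / h) * h.
    by move=> hn; rewrite (mulNr k) opprK divfK.
  by apply: T; rewrite gt_eqF.
have sb : smooth_on (U i) (form_coef b i) by exact: form_smooth.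
move=> k; have := euler_lagrange_reversal (@oU i) (@sF i) sb (@F_homo i)
  (fun x y _ => @F_opp i x y) rc dthn d2th (th_decr t Ot) EL1 k.
(* The remainder is [ext_derivative b] on c' and the k-th basis vector. *)
have -> : 'D_(derive1 (local_curve c i) (theta t))
    (fun z => lin_form (form_coef b i z) (delta_mx 0 k)) (local_curve c i (theta t)) -
   'D_(delta_mx 0 k) (fun z => lin_form (form_coef b i z)
     (derive1 (local_curve c i) (theta t))) (local_curve c i (theta t)) = 0.
  by apply: (b_closed i); exact: chart_img_local_curve vi.
by rewrite mulr0 addr0.
Qed.

End finsler_curves.

Section rescaling.
Context {R : realType} {n : nat}.
Local Notation V := 'rV[R]_n.
Variables (U : set V) (L : V -> V -> R).
Hypotheses (oU : open U) (sL : smooth_on (slit U) (joint L)).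
Hypothesis (L_homo : forall x y (l : R), U x -> 0 < l -> L x (l *: y) = l * L x y).

(** Both sides are multiplied by a^2. The energy has degree 2 in y, so its x-derivative scales by
    a^2, while its y-derivative scales by a and d/dt contributes the other a. *)
Lemma euler_lagrange_rescale (z : R -> V) (a t : R) : 0 < a ->
  (\forall s \near a * t, derivable z s 1 /\ slit U (z s, derive1 z s)) ->
  euler_lagrange (half_square L) z (a * t) ->
  euler_lagrange (half_square L) (fun s => z (a * s)) t.
Proof.
move=> a0 Hz EL k; set v := delta_mx 0 k.
have da (s : R) : is_derive s 1 (fun s : R => a * s) a.
  by have := is_derive_scaler a s (1 : R); rewrite [a *: 1]mulr1.
have ca : {for t, continuous (fun s : R => a * s)}.
  apply: differentiable_continuous; apply/derivable1_diffP.
  exact: (@ex_derive _ _ _ _ _ _ _ (da t)).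
have Hz' := near_comp ca Hz.
have dz : \forall s \near t, derive1 (fun s => z (a * s)) s = a *: derive1 z (a * s).
  apply: filterS Hz' => s [ds _].
  rewrite (derive1_comp_scalar (@ex_derive _ _ _ _ _ _ _ (da s)) ds).
  by rewrite [in LHS]derive1E (@derive_val _ _ _ _ _ _ _ (da s)).
have E : \forall s \near t, a * 'D_v (half_square L (z (a * s))) (derive1 z (a * s)) =
    'D_v (half_square L (z (a * s))) (derive1 (fun s => z (a * s)) s).
  apply: filterS (filterI Hz' dz) => s [[_ [/= Us ys]] ->].
  rewrite (derive_half_square_snd oU sL)// (derive_half_square_snd oU sL)//; last first.
    by rewrite scaler_eq0 negb_or gt_eqF.
  by rewrite (derive_homogeneous oU sL L_homo)// L_homo// mulrA.
apply: near_eq_is_derive E _.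
have [_ [/= Ut yt]] := nbhs_singleton Hz.
have -> : 'D_v (fun x => half_square L x (derive1 (fun s => z (a * s)) t)) (z (a * t)) =
    a *: (a *: 'D_v (fun x => half_square L x (derive1 z (a * t))) (z (a * t))).
  rewrite (nbhs_singleton dz) (derive_half_square_fst oU sL)//; last first.
    by rewrite scaler_eq0 negb_or gt_eqF.
  rewrite (derive_half_square_fst oU sL)// (derive_homogeneous_fst oU sL L_homo)//.
  rewrite L_homo//; set p := L _ _; set q := 'D_v _ _.
  rewrite -[RHS]/(a * (a * (p * q))); ring.
exact: is_deriveZ (is_derive_comp_scalar (da t) (EL k)).
Qed.

End rescaling.

Section chart_curves.
Context {R : realType} {n : nat} {M : topologicalType} (A : smooth_atlas R n M).
Local Notation V := 'rV[R]_n.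
Variables (O : set R) (i : chart A) (z : R -> V).
Hypotheses (oO : open O) (sz : smooth_on O z)
  (zi : forall t, O t -> chart_img (A := A) i (z t)).

Lemma chart_img_inv x : chart_img (A := A) i x ->
  chart_dom A i (chart_inv A i x) /\ chart_map A i (chart_inv A i x) = x.
Proof. by move=> [p pi <-]; rewrite chart_mapK. Qed.

Lemma smooth_curve_chart_inv : smooth_curve A O (fun t => chart_inv A i (z t)).
Proof.
have cz t : O t -> {for t, continuous (fun t => chart_inv A i (z t))}.
  move=> Ot; apply: (@continuous_comp _ _ _ z (chart_inv A i)).
    exact: smooth_continuous sz Ot.
  by apply: chart_inv_continuous; exact: zi.
split=> // j.
have oj : open (O `&` ((fun t => chart_inv A i (z t)) @^-1` chart_dom A j)).
  apply: open_locally => t [Ot jt].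
  apply: filterI; first exact: open_near oO Ot.
  exact: (near_comp (cz t Ot) (open_near (chart_dom_open (s := A) j) jt)).
apply: (smooth_comp_vec (f := transition (A := A) i j) oj (open_overlap (i := i) (j :=
  j)) _ _ _).
- by apply: smooth_subset sz => t [].
- move=> t [Ot jt]; have [it zE] := chart_img_inv (zi Ot).
  by exists (chart_inv A i (z t)).
- exact: chart_transition_smooth.
Qed.

Lemma local_curve_chart_inv t : O t ->
  z t = local_curve (fun t => chart_inv A i (z t)) i t.
Proof. by move=> /zi/chart_img_inv[_ E]; rewrite /local_curve /= E. Qed.

End chart_curves.

Section reversible_closed.
Context {R : realType} {n : nat} {M : topologicalType} (A : smooth_atlas R n M).
Local Notation V := 'rV[R]_n.
Variable F : local_expr A.
Hypothesis F_finsler : finsler_metric F.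

Let U (i : chart A) : set V := chart_img (A := A) i.

Let oU i : open (U i). Proof. exact: chart_img_open. Qed.

Let sF i : smooth_on (slit (U i)) (joint (F i)).
Proof. exact: (finsler_smooth F_finsler). Qed.

Let F_homo i x y (l : R) : U i x -> 0 < l -> F i x (l *: y) = l * F i x y.
Proof. exact: (finsler_homogeneous F_finsler). Qed.

Let F_pos i x y : U i x -> y != 0 -> 0 < F i x y.
Proof. exact: (finsler_pos F_finsler). Qed.

Lemma euler_lagrange_local_curve (O : set R) (c : R -> M) (i j : chart A) t :
  open O -> smooth_curve A O c -> visits O c i t -> visits O c j t ->
  derive1 (local_curve c i) t != 0 ->
  euler_lagrange (half_square (F i)) (local_curve c i) t ->
  euler_lagrange (half_square (F j)) (local_curve c j) t.
Proof.
move=> oO sc it jt c0 EL.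
have nij : \forall s \near t, visits O c i s /\ visits O c j s.
  apply: filterI.
    exact: open_near (open_visits oO sc (i := i)) it.
  exact: open_near (open_visits oO sc (i := j)) jt.
have E : \forall s \near t, local_curve c i s = transition j i (local_curve c j s).
  by apply: filterS nij => s [_ js]; exact: local_curve_transition js.
have c0j := derive1_local_curve_neq0 oO sc it jt c0.
have [dcn _ _] := regular_local_curve oO sc jt c0j.
have sK : smooth_on (overlap (A := A) j i) (transition (A := A) j i).
  exact: chart_transition_smooth.
(* The equations pass from the target of [K] to its source, so the transition goes from [j] to [i];
   compatibility exhibits F in chart [j] as the pullback of F in chart [i]. *)
apply: (euler_lagrange_chart (L := half_square (F i)) (K := transition j i)
  (open_overlap (i := j) (j := i)) (@oU i) sK (smooth_half_square (@oU i) (@sF i))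
  _ _ (nbhs_singleton dcn) _ dcn
  (near_regular_at E (regular_local_curve oO sc it c0)) (near_euler_lagrange E EL)).
- move=> x [p [pj pi] <-]; exists p => //.
  by rewrite /transition/= chart_mapK.
- by move=> x y ov; rewrite /half_square (finsler_compat F_finsler y ov).
- by apply: filterS nij => s [vi vj]; exact: overlap_local_curve vj vi.
Qed.

(** The spray is solved in the single chart [i]; the solution is carried to the manifold by
    [chart_inv], and its equations to every other chart that the curve meets. The factor [a] comes
    from fitting a short solution to [0, 1]. *)
Lemma geodesic_exists i (x y : V) : U i x -> y != 0 ->
  exists2 c : R -> M, geodesic F c & exists2 a : R, 0 < a &
    [/\ chart_dom A i (c 0), local_curve c i 0 = x &
        derive1 (local_curve c i) 0 = a *: y].
Proof.
move=> Ux y0.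
have sE := smooth_half_square (@oU i) (@sF i).
have convex x' y' v : U i x' -> y' != 0 -> v != 0 ->
    0 < 'D_(0, v) ('D_(0, v) (joint (half_square (F i)))) (x', y').
  move=> Ux' y'0 v0; rewrite (hessian_half_square (@oU i) (@sF i))//.
  exact: (finsler_convex F_finsler Ux' y'0 v0).
have [d d0 [z [z0 z'0 sz Hz]]] := euler_lagrange_exists (@oU i) sE convex Ux y0.
(* On (-1, 2), a neighbourhood of [0, 1], |t| < 2 and hence |a t| < d. *)
pose a := d / 2.
have a0 : 0 < a by rewrite divr_gt0.
pose O : set R := `]- 1, 1 + 1[%classic.
have oO : open O by exact: interval_open.
have Oa t : O t -> `|a * t| < d.
  rewrite /O/= in_itv/= => /andP[t1 t2]; rewrite normrM (gtr0_norm a0) /a.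
  have t2' : `|t| < 2 by rewrite ltr_norml; apply/andP; split; lra.
  by rewrite -mulrA gtr_pMr// mulrC ltr_pdivrMr// mul1r.
have da (s : R) : is_derive s 1 (fun s : R => a * s) a.
  by have := is_derive_scaler a s (1 : R); rewrite [a *: 1]mulr1.
have sw : smooth_on O (fun t => z (a * t)).
  have od : open [set t : R | `|t| < d].
    by apply: open_locally => t /= td; exact: near_norm_lt.
  have sa : smooth_on O (fun t : R => a * t).
    exact: (smoothM oO (smooth_cst oO a) (smooth_id (fV := finite_dim_R R) oO)).
  by apply: (smooth_comp_vec oO od sa _ sz) => t /Oa.
have wi t : O t -> U i (z (a * t)) by move=> /Oa /Hz[[]].
have nz t : O t -> \forall s \near a * t, derivable z s 1 /\ slit (U i) (z s, derive1 z s).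
  move=> /Oa td; apply: filterS (near_norm_lt td) => s sd; split;
    last by have [] := Hz s sd.
  exact: smooth_derivable sz sd.
pose c t := chart_inv A i (z (a * t)).
have sc : smooth_curve A O c by exact: (smooth_curve_chart_inv oO sw).
have cE t : O t -> \forall s \near t, z (a * s) = local_curve c i s.
  move=> Ot; apply: filterS (open_near oO Ot) => s Os.
  exact: (local_curve_chart_inv wi Os).
have vi t : O t -> visits O c i t.
  by move=> Ot; split => //; have [] := chart_img_inv (wi t Ot).
have dcE t : O t -> derive1 (local_curve c i) t = a *: derive1 z (a * t).
  move=> Ot; rewrite -(nbhs_singleton (near_derive1 (cE t Ot))).
  have [ds _] := nbhs_singleton (nz t Ot).
  rewrite (derive1_comp_scalar (@ex_derive _ _ _ _ _ _ _ (da t)) ds).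
  by rewrite [in LHS]derive1E (@derive_val _ _ _ _ _ _ _ (da t)).
have O0 : O 0 by rewrite /O/= in_itv/=; apply/andP; split; lra.
exists c.
  apply/geodesicP; split; first by exists 1.
  move=> t j /andP[t0 t1] jt.
  have Ot : O t by rewrite /O/= in_itv/=; apply/andP; split; lra.
  have vj : visits O c j t by [].
  have ci0 : derive1 (local_curve c i) t != 0.
    rewrite dcE// scaler_eq0 negb_or gt_eqF//=.
    by have [[]] := Hz _ (Oa t Ot).
  have cj0 := derive1_local_curve_neq0 oO sc (vi t Ot) vj ci0.
  have ELz : euler_lagrange (half_square (F i)) z (a * t) by have [] := Hz _ (Oa t Ot).
  have ELw := euler_lagrange_rescale (@oU i) (@sF i) (@F_homo i) a0 (nz t Ot) ELz.
  have ELi := near_euler_lagrange (cE t Ot) ELw.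
  by split; last exact: (euler_lagrange_local_curve oO sc (vi t Ot) vj ci0 ELi).
exists a => //; split.
- by have [] := vi 0 O0.
- by rewrite -(nbhs_singleton (cE 0 O0)) mulr0.
- by rewrite dcE// mulr0 z'0.
Qed.

Variable b : one_form A.
Hypothesis F_opp : forall i x y, F i x (- y) = F i x y - 2 * lin_form (form_coef b i x) y.

(** A geodesic from [x] and its reverse both satisfy the equations of F at [x]. Uniqueness of the
    derivative of the reversed momentum then leaves 2 theta' d beta(a u, .) = 0, with theta' < 0 and
    a > 0. *)
Lemma reversible_closed_form : reversible_geodesics F -> closed_form b.
Proof.
move=> rev i x u v Ux.
(* No geodesic leaves in direction 0, where both terms of the exterior derivative vanish
   directly. *)
have [->|u0] := eqVneq u 0.
  rewrite /ext_derivative derive0 sub0r.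
  have -> : (fun z => form_fun b i z 0) = cst 0.
    by apply/funext => z; rewrite /form_fun /lin_form big1// => k _; rewrite mxE mulr0.
  by rewrite derive_cst oppr0.
have sb : smooth_on (U i) (form_coef b i) by exact: form_smooth.
have dlin w : differentiable (fun z => lin_form (form_coef b i z) w) x.
  exact: (smooth_differentiable (@oU i) (lin_form_smooth (@oU i) sb w) Ux).
have [c gc [a a0 [it cx cu]]] := geodesic_exists Ux u0.
have id_rep : reparametrization (id : R -> R).
  split => //; first by exists 1 => //; apply: smooth_id; exact: interval_open.
  by move=> t _; rewrite derive1_id.
have : geodesic_path F (fun t => c (1 - t)) by apply: rev; exists id.
move=> [psi [[ep ep0 spsi] psi0 psi1 dpsi]] /geodesicP[[ed ed0 sd] Hd].
move/geodesicP : gc => [[ec ec0 sc] Hc].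
(* [c] composed with this decreasing parameter is the reversed path in its geodesic
   parametrization. *)
pose theta t : R := 1 - psi t.
pose Op : set R := `]- ep, 1 + ep[%classic.
have oOp : open Op by exact: interval_open.
have oOc : open (`]- ec, 1 + ec[%classic : set R) by exact: interval_open.
have h01 : 0 <= (1 : R) <= 1 by apply/andP; split; lra.
have h00 : 0 <= (0 : R) <= 1 by apply/andP; split; lra.
have O1 : Op 1 by rewrite /Op/= in_itv/=; apply/andP; split; lra.
(* The reversed path ends where [c] starts, so the comparison at [x] takes place at time 1. *)
have th1 : theta 1 = 0 by rewrite /theta psi1 subrr.
have sth : smooth_on Op theta by exact: (smoothB oOp (smooth_cst oOp 1) spsi).
have dthn : \forall s \near (1 : R), derivable theta s 1.
  by apply: filterS (open_near oOp O1) => s Os; exact: smooth_derivable sth Os.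
have d2th : derivable (derive1 theta) 1 1.
  have -> : derive1 theta = 'D_1 theta by apply/funext => s; rewrite derive1E.
  have s1 : smooth_on Op ('D_1 theta) by exact: smooth_derive.
  exact: smooth_derivable s1 O1.
have th_decr : derive1 theta 1 < 0.
  have dp : is_derive (1 : R) 1 psi (derive1 psi 1).
    by rewrite derive1E; apply: derivableP; exact: smooth_derivable spsi O1.
  have D : is_derive (1 : R) 1 theta (0 - derive1 psi 1) by exact: is_deriveB.
  by rewrite derive1E (@derive_val _ _ _ _ _ _ _ D) sub0r oppr_lt0 dpsi.
have [c0 EL] := Hc 0 i h00 it.
have vi : visits `]- ec, 1 + ec[ c i 0.
  by split => //; rewrite /= in_itv/=; apply/andP; split; lra.
have rc := regular_local_curve oOc sc vi c0.
have [_ EL1] := (euler_lagrange_half_square (@oU i) (@sF i) (@F_homo i) (@F_pos i) rc).1 EL.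
have dE : (fun t => c (1 - t)) \o psi = (fun t => c (theta t)) by [].
rewrite dE in Hd.
have it1 : chart_dom A i (c (theta 1)) by rewrite th1.
have [d0 ELd] := Hd 1 i h01 it1.
rewrite -th1 in rc EL1.
have rd := regular_at_reversal (@oU i) rc dthn d2th th_decr.
have [_ ELd1] := (euler_lagrange_half_square (@oU i) (@sF i) (@F_homo i) (@F_pos i)
  rd).1 ELd.
have key k : 'D_u (fun z => lin_form (form_coef b i z) (delta_mx 0 k)) x =
    'D_(delta_mx 0 k) (fun z => lin_form (form_coef b i z) u) x.
  have D := euler_lagrange_reversal (@oU i) (@sF i) sb (@F_homo i)
    (fun x y _ => @F_opp i x y) rc dthn d2th th_decr EL1 k.
  have := is_derive_unique D (ELd1 k).
  rewrite th1 cx cu => /eqP; rewrite -subr_eq0 addrAC subrr add0r.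
  rewrite mulf_eq0 mulf_eq0 (lt_eqF th_decr) pnatr_eq0/= subr_eq0 => /eqP.
  (* The velocity of [c] at 0 is a u; both terms are linear in it, so [a] cancels. *)
  rewrite (deriveZ_dir _ _ (dlin _)).
  have -> : (fun z => lin_form (form_coef b i z) (a *: u)) =
      a \*: (fun z => lin_form (form_coef b i z) u).
    apply/funext => z; rewrite /lin_form /= scaler_sumr; apply: eq_bigr => l _.
    by rewrite mxE mulrCA.
  rewrite (deriveZ a (diff_derivable (dlin u))).
  by move=> /(@scalerI _ _ a (lt0r_neq0 a0)).
(* The identity is known for basis vectors; expanding [v] in the basis extends it by linearity. *)
have Dv : is_derive x u (fun z => \sum_k v 0 k * lin_form (form_coef b i z) (delta_mx 0 k))
    (\sum_k v 0 k *: 'D_u (fun z => lin_form (form_coef b i z) (delta_mx 0 k)) x).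
  by apply: is_derive_sum_fun => k; apply: is_deriveZ;
    exact: derivableP (diff_derivable (dlin _)).
rewrite /ext_derivative /form_fun.
have -> : (fun z => lin_form (form_coef b i z) v) =
    (fun z => \sum_k v 0 k * lin_form (form_coef b i z) (delta_mx 0 k)).
  apply/funext => z; rewrite {1}/lin_form; apply: eq_bigr => k _.
  rewrite /lin_form (bigD1 k)//= mxE !eqxx mulr1 big1 ?addr0 1?mulrC// => l lk.
  by rewrite mxE eqxx (negPf lk) mulr0.
rewrite (@derive_val _ _ _ _ _ _ _ Dv) (derive_delta v (dlin u)).
by apply/eqP; rewrite subr_eq0; apply/eqP; apply: eq_bigr => k _; rewrite key.
Qed.

End reversible_closed.

Theorem theorem3p1 (R : realType) (n : nat) (M : topologicalType)
    (A : smooth_manifold R n M) (M_connected : connected [set: M])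
    (alpha : riemannian_metric A) (beta : one_form A)
    (F_finsler : finsler_metric (randers_change (quartic_metric alpha beta) beta)) :
  reversible_geodesics (randers_change (quartic_metric alpha beta) beta) <->
  closed_form beta.
Proof.
have F_opp := randers_opp alpha beta.
split; first exact: reversible_closed_form F_finsler _ F_opp.
exact: closed_form_reversible F_finsler _ F_opp.
Qed.
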